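(* Let $(X,\mathbb{P})$ be a recurrent one-dimensional Lévy process with characteristic exponent $\Psi$ such that $\int_0^\infty \left|\frac{1}{q+\Psi(\lambda)}\right| d\lambda<\infty$ for each $q>0$. Let $h$ be its renormalized zero resolvent and $m^2=\mathbb{P}[X_1^2]\in(0,\infty]$ (with $1/\infty=0$). For $-1\le\gamma\le1$ define $$h^{(\gamma)}(x)=h(x)+\frac{\gamma}{m^2}x,\qquad x\in\mathbb{R}.$$ Then $h^{(\gamma)}$ is subadditive on $\mathbb{R}$ and $h^{(\gamma)}(x)\ge0$ for all $x\in\mathbb{R}$.
   Context: $(X=(X_t)_{t\ge0},\mathbb{P}_x)$ is the canonical representation of a one-dimensional Lévy process started from $x$, and $\mathbb{P}=\mathbb{P}_0$; $\mathbb{P}[\cdot]$ also denotes expectation. The characteristic exponent $\Psi$ is defined by $\mathbb{P}[e^{\mathrm{i}\lambda X_t}]=e^{-t\Psi(\lambda)}$. Recurrent means: $\mathbb{P}\left[\int_0^\infty 1_{\{|X_t-a|<\varepsilon\}}dt\right]=\infty$ for all $a\in\mathbb{R}$, $\varepsilon>0$. Under the integrability assumption on $\Psi$, for each $q>0$ there is a bounded continuous $q$-resolvent density $r_q$, i.e. $\int_{\mathbb{R}}f(x)r_q(x)\,dx=\mathbb{P}\left[\int_0^\infty e^{-qt}f(X_t)\,dt\right]$ for all non-negative measurable $f$. Put $h_q(x)=r_q(0)-r_q(-x)$; the limit $h(x)=\lim_{q\to0+}h_q(x)$ exists and is finite for every $x\in\mathbb{R}$, and $h$ is called the renormalized zero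 resolvent. *)

(* Defs.v *)
From HB Require Import structures.
From mathcomp Require Import all_boot all_order all_algebra.
From mathcomp Require Import all_classical all_reals all_analysis.
From mathcomp Require Import complex.

Set Implicit Arguments.
Unset Strict Implicit.
Unset Printing Implicit Defensive.

Import Order.TTheory GRing.Theory Num.Theory.
Import numFieldNormedType.Exports.

Local Open Scope classical_set_scope.
Local Open Scope ring_scope.

Section Levy.
Context {R : realType} {d : measure_display} {Omega : measurableType d}.
Variable P : probability Omega R.
Variable X : R -> {RV P >-> R}.

(** Only the times [t >= 0] are meaningful; the random variables [X t] with
    [t < 0] are left arbitrary, and nothing below depends on them. *)

Definition increment (s t : R) (w : Omega) : R := X t w - X s w.

Definition independent_increments :=
  forall (t : nat -> R) (n : nat) (A : nat -> set R),
    0 <= t 0%N ->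
    {homo t : i j / (i <= j)%N >-> i <= j} ->
    (forall i, measurable (A i)) ->
    P (\bigcap_(i < n) (increment (t i) (t i.+1) @^-1` A i)) =
    (\prod_(i < n) P (increment (t i) (t i.+1) @^-1` A i))%E.

Definition stationary_increments :=
  forall (s t : R) (A : set R), 0 <= s -> s <= t -> measurable A ->
    P (increment s t @^-1` A) = P (X (t - s) @^-1` A).

Definition cadlag (x : R -> R) :=
  (forall t, 0 <= t -> x s @[s --> t^'+] --> x t) /\
  (forall t, 0 < t -> cvg (x s @[s --> t^'-])).

(** All paths, and not only almost all of them, are càdlàg: the canonical
    representation lives on the space of càdlàg paths. *)
Record levy_process : Prop := LevyProcess {
  levy_start : P [set w | X 0 w = 0] = 1%E;
  levy_independent : independent_increments;
  levy_stationary : stationary_increments;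
  levy_cadlag : forall w, cadlag (fun t => X t w) }.

Definition recurrent :=
  forall a eps : R, 0 < eps ->
    (\int[P]_w \int[lebesgue_measure]_(t in `[0%R, +oo[)
      (\1_[set y : R | `|y - a| < eps] (X t w))%:E = +oo)%E.

Definition cexp (z : R[i]) : R[i] :=
  Complex (expR (complex.Re z) * cos (complex.Im z))
          (expR (complex.Re z) * sin (complex.Im z)).

Definition char_fun (t lambda : R) : R[i] :=
  Complex (\int[P]_w cos (lambda * X t w)) (\int[P]_w sin (lambda * X t w)).

Definition characteristic_exponent (Psi : R -> R[i]) :=
  forall t lambda : R, 0 <= t ->
    char_fun t lambda = cexp (- (real_complex R t * Psi lambda)).

(** [Normc.normc] is the real-valued modulus of a complex number. *)
Definition integrable_exponent (Psi : R -> R[i]) :=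
  forall q : R, 0 < q ->
    (\int[lebesgue_measure]_(lambda in `[0%R, +oo[)
      (Normc.normc (1 / (real_complex R q + Psi lambda)))%:E < +oo)%E.

(** Continuity makes the density unique. *)
Definition resolvent_density (q : R) (r : R -> R) :=
  [/\ [bounded r x | x in [set: R]],
      continuous r &
      forall f : R -> R, measurable_fun [set: R] f -> (forall x, 0 <= f x) ->
        (\int[lebesgue_measure]_x (f x * r x)%:E =
         \int[P]_w \int[lebesgue_measure]_(t in `[0%R, +oo[)
           (expR (- (q * t)) * f (X t w))%:E)%E].

Definition renormalized_zero_resolvent (h : R -> R) :=
  exists r : R -> R -> R,
    (forall q, 0 < q -> resolvent_density q (r q)) /\
    (forall x, r q 0 - r q (- x) @[q --> 0^'+] --> h x).

Definition second_moment : \bar R := 'E_P[fun w => X 1 w ^+ 2].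

(** The inverse is taken in the extended reals, where [+oo^-1 = 0]. *)
Definition h_gamma (h : R -> R) (gamma : R) (x : R) : R :=
  h x + gamma * fine (second_moment^-1)%E * x.

End Levy.

Definition subadditive_fun {R : realType} (f : R -> R) :=
  forall x y : R, f (x + y) <= f x + f y.

(* Main.v *)
From HB Require Import structures.
Require Import Defs.
From mathcomp Require Import all_boot all_order all_algebra.
From mathcomp Require Import all_classical all_reals all_analysis.
From mathcomp Require Import measurable_realfun complex ring lra.

(** Write [r] for the density of the [q]-resolvent, [U F] for the integral of
    [F] against [r] and [P_s F (x)] for the mean of [F (x + X_s)].  The
    argument rests on one identity, the resolvent cut at time [s]
    ([resolvent_identity_ge0]):

      U F = (integral over t in [0, s[ of e^(- q t) E F(X_t))
            + e^(- q s) U (P_s F).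

    Subadditivity.  Since [r a / r 0] is the Laplace transform of the hitting
    time of [a], visiting an intermediate point gives the inequality
    [r a * r b <= r 0 * r (a + b)].  Hitting times and the strong Markov
    property are replaced by a domination principle ([domination]): if a
    multiple of the potential of a small interval around [0] lies below another
    potential near that interval, then it lies below it everywhere, because
    from a point far from the interval the process is unlikely to reach it in
    a short time.  This yields [r <= r 0] ([resolvent_le0]) and the product
    inequality ([resolvent_mul_le]), from which [r 0 - r (- x)] is
    non-negative and subadditive; so is its limit [h] as [q] tends to [0].

    Non-negativity.  It remains to see that [h x >= |x| / m^2]
    ([zero_resolvent_ge]), where [m^2] may be assumed finite.  Recurrence
    forces [r 0] to tend to infinity, so that the ratio
    [psi y = r (- y) / r 0] tends to [1] everywhere, and this in turn forces
    [X_1] to be centered ([zero_mean]).  Then the resolvent obeys a central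
    limit theorem ([weak_limit]): for [g = f - (m^2 / 2) f''], the integral
    of [q * g (sqrt q * x) * r x] tends to [f 0].  So [q r], rescaled by [1 / sqrt q],
    tends weakly to the two-sided exponential law of rate
    [beta = sqrt (2 / m^2)], whose density at [0] is [beta / 2].  On the other
    hand the product inequality says that [psi] is supermultiplicative; it is
    therefore, asymptotically, at least an exponential of rate
    [h x / (x * r 0)].  Testing the
    weak limit against functions that live on one half-line gives first
    [sqrt q * r 0 >= beta / 2] up to an error that vanishes, then compares the
    two rates, which is the bound on [h] ([slope_le]).  Working on one
    half-line at a time is what makes the bound two-sided, and hence absorbs
    the linear term [gamma * x / m^2] for all [gamma] in [-1, 1]. *)

Set Implicit Arguments.
Unset Strict Implicit.
Unset Printing Implicit Defensive.

Import Order.TTheory GRing.Theory Num.Theory.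
Import numFieldNormedType.Exports.

Local Open Scope classical_set_scope.
Local Open Scope ring_scope.

(** * Invariance of the Lebesgue measure and regularity of the paths *)

Section lebesgue_invariance.
Context {R : realType}.
Implicit Type f : R -> \bar R.
Local Notation mu := (@lebesgue_measure R).
Local Notation G := (measurableTypeR R).

Lemma lebesgue_measure_shift (c : R) (A : set R) : measurable A ->
  pushforward mu ((fun x => x + c) : G -> G) A = mu A.
Proof.
have mc : measurable_fun setT ((fun x => x + c) : G -> G) by exact: measurable_funD.
move=> mA; apply/esym/lebesgue_measure_unique => //= _ [[a b] _ <-].
have -> : pushforward mu ((fun x : G => x + c) : G -> G) `]a, b] = mu `]a - c, b - c].
  rewrite /pushforward; congr mu; apply/seteqP; split => x /=;
    by rewrite !in_itv/= ltrBlDr lerBrDr.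
rewrite !lebesgue_measure_itv/= !lte_fin ltrD2r.
by case: ifP => // _; congr (_%:E); rewrite opprB addrA subrK.
Qed.

Lemma ge0_integral_shift f (c : R) : measurable_fun [set: R] f ->
  (forall x, (0 <= f x)%E) -> (\int[mu]_x f (x + c)%R = \int[mu]_x f x)%E.
Proof.
move=> mf f0.
have mc : measurable_fun setT ((fun x => x + c) : G -> G) by exact: measurable_funD.
rewrite -[LHS](@ge0_integral_pushforward _ _ G G R _ mc mu setT f)//.
by apply: eq_measure_integral => //= A mA _; exact: lebesgue_measure_shift.
Qed.

Lemma ge0_integral_reflect f : measurable_fun [set: R] f ->
  (forall x, (0 <= f x)%E) -> (\int[mu]_x f (- x)%R = \int[mu]_x f x)%E.
Proof.
move=> mf f0.
have mN : measurable_fun setT (-%R : G -> G) by exact: measurable_funN.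
rewrite -[LHS](@ge0_integral_pushforward _ _ G G R _ mN mu setT f)//.
by apply: eq_measure_integral => //= A mA _; exact: lebesgue_measureN.
Qed.

End lebesgue_invariance.

Section paths.
Context {R : realType} {d : measure_display} {Omega : measurableType d}.
Variable P : probability Omega R.
Variable X : R -> {RV P >-> R}.
Hypothesis X_levy : levy_process X.

Let step n (t : R) : R := (Num.truncn (n.+1%:R * Num.max 0 t)).+1%:R / n.+1%:R.

(** The strict inequality [Num.max 0 t < step n t] is what lets the
    right-continuity of the paths apply. *)
Let step_gt n t : Num.max 0 t < step n t.
Proof.
rewrite /step ltr_pdivlMr ?ltr0n// mulrC.
rewrite truncnS_gt//.
Qed.

Let step_le n t : step n t <= Num.max 0 t + n.+1%:R^-1.
Proof.
rewrite /step -natr1 mulrDl mul1r lerD2r ler_pdivrMr ?ltr0n// mulrC.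
by rewrite truncn_le// mulr_ge0// le_max lexx.
Qed.

Lemma path_right_cvg w t (u : R^nat) : 0 <= t -> (forall n, t < u n) ->
  u n @[n --> \oo] --> t -> X (u n) w @[n --> \oo] --> X t w.
Proof.
move=> t0 tu ut; have [rc _] := levy_cadlag X_levy w.
by have /cvg_at_rightP := rc t t0; apply.
Qed.

(** Joint measurability is what allows the expectation and the time integral
    to be exchanged. It holds because a right-continuous path is the limit of
    its values along a countable set of times. Truncating the time at [0]
    discards the random variables indexed by negative times, about which
    nothing is known. *)
Lemma measurable_path :
  measurable_fun [set: Omega * R] (fun z => X (Num.max 0 z.2) z.1).
Proof.
apply: (@measurable_fun_cvg _ _ _ _ (fun n z => X (step n z.2) z.1)).
- move=> n _ A mA; rewrite setTI.
  have -> : (fun z : Omega * R => X (step n z.2) z.1) @^-1` A =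
     \bigcup_k ((X (k.+1%:R / n.+1%:R) @^-1` A) `*`
       [set t | Num.truncn (n.+1%:R * Num.max 0 t) = k]).
    apply/seteqP; split => [[w t] /= h|[w t] [k _] [/= h hk]].
      by exists (Num.truncn (n.+1%:R * Num.max 0 t)).
    by rewrite /step hk.
  apply: bigcup_measurable => k _; apply: measurableX.
    by rewrite -[X in measurable X]setTI; exact: measurable_funPT.
  have -> : [set t : R | Num.truncn (n.+1%:R * Num.max 0 t) = k] =
      (fun t => n.+1%:R * Num.max 0 t) @^-1` `[k%:R, k.+1%:R[.
    have h0 t : 0 <= n.+1%:R * Num.max 0 t :> R by rewrite mulr_ge0// le_max lexx.
    apply/seteqP; split => t /=.
      by move=> <-; rewrite in_itv/= truncn_le ?h0// truncnS_gt.
    by rewrite in_itv/= -truncn_eq// => /eqP.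
  have mh : measurable_fun [set: R] (fun t : R => n.+1%:R * Num.max 0 t).
    by apply: measurable_funM => //; exact: measurable_maxr.
  rewrite -[X in measurable X]setTI; exact: mh.
- move=> [w t] _ /=; apply: path_right_cvg => //.
    by rewrite le_max lexx.
  apply: (@squeeze_cvgr _ _ _ _ (cst (Num.max 0 t)) (fun n => Num.max 0 t + n.+1%:R^-1)).
  + by apply: nearW => n; rewrite step_le andbT; exact: ltW (step_gt n t).
  + exact: cvg_cst.
  + rewrite -[X in _ --> X]addr0; apply: cvgD; first exact: cvg_cst.
    exact: cvg_harmonic.
Qed.

Lemma start0 : {ae P, forall w, X 0 w = 0}.
Proof.
have mE : measurable [set w | X 0 w = 0].
  rewrite -[X in measurable X]setTI.
  exact: (measurable_funPT (X 0) measurableT _ (measurable_set1 0)).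
apply/negligibleP; first exact: measurableC.
transitivity (1 - P [set w | X 0%R w = 0%R])%E; first exact: probability_setC.
by rewrite (levy_start X_levy) subee.
Qed.

(** Right-continuity at time [0] gives [X t -> 0] almost surely, hence in
    probability; an offending sequence of times would contradict dominated
    convergence. *)
Lemma prob_small_time (e c : R) : 0 < e -> 0 < c ->
  exists2 s : R, 0 < s & forall t, 0 <= t <= s ->
    (P [set w | (e <= `|X t w|)%R] <= c%:E)%E.
Proof.
move=> e0 c0; apply: contrapT => /forall2NP h.
have /choice[u hu] : forall n, exists t, (0 <= t <= n.+1%:R^-1) /\
    ~ (P [set w | (e <= `|X t w|)%R] <= c%:E)%E.
  move=> n; have [|/existsNP[t /not_implyP[t1 t2]]] := h n.+1%:R^-1.
    by rewrite invr_gt0 ltr0n.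
  by exists t.
have mS t : measurable [set w | (e <= `|X t w|)%R].
  rewrite -[X in measurable X]setTI.
  apply: (@measurable_fun_le _ _ _ _ (cst e)) => //; apply: measurableT_comp => //.
have u0 n : 0 < u n.
  have [/andP[h1 _] h2] := hu n; rewrite lt_neqAle h1 andbT; apply/eqP => h3.
  apply: h2; rewrite -h3; apply: (@le_trans _ _ 0%E); last by rewrite lee_fin ltW.
  have /negligibleP : P.-negligible [set w | (e <= `|X 0 w|)%R].
    apply: negligibleS start0 => w /= he h0; move: he.
    by rewrite h0 normr0 leNgt e0.
  by move=> /(_ (mS 0)) ->.
have cvu : u n @[n --> \oo] --> 0.
  apply: (@squeeze_cvgr _ _ _ _ (cst 0) (fun n => n.+1%:R^-1)).
  + by apply: nearW => n; have [/andP[h1 h2] _] := hu n; rewrite h1 h2.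
  + exact: cvg_cst.
  + exact: cvg_harmonic.
have /(_ _)[] := @dominated_convergence _ _ _ P setT measurableT
  (fun n w => (\1_[set w | (e <= `|X (u n) w|)%R] w)%:E) (cst 0%E) (cst 1%E).
- by move=> n; apply/measurable_EFinP; exact: measurable_indic.
- exact: measurable_cst.
- apply: filterS start0 => w hw _.
  have hc := @path_right_cvg w _ _ (lexx 0) u0 cvu; rewrite hw in hc.
  apply: cvg_near_cst; move/cvgrPdist_lt : hc => /(_ _ e0); apply: filterS => n.
  rewrite sub0r normrN => hn; rewrite indicE memNset//=.
  by apply/negP; rewrite -ltNge.
- exact: finite_measure_integrable_cst.
- by apply: aeW => w n _; rewrite lee_fin ger0_norm// indicE; case: (_ \in _).
move=> _ _; rewrite integral0 => hcv.
have : P [set w | (e <= `|X (u n) w|)%R] @[n --> \oo] --> 0%E.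
  apply: cvg_trans hcv; apply: near_eq_cvg; apply: nearW => n /=.
  by rewrite integral_indic// setIT.
move/fine_cvgP => [_ /cvgrPdist_lt /(_ _ c0)] [N _ /(_ N (leqnn N))] /=.
rewrite sub0r normrN => hN.
have [_ []] := hu N; rewrite -[X in (X <= _)%E]fineK ?fin_num_measure//.
by rewrite lee_fin (le_trans (ler_norm _))// ltW.
Qed.

End paths.

(** * The convolution semigroup of the one-dimensional laws *)

Section semigroup.
Context {R : realType} {d : measure_display} {Omega : measurableType d}.
Variable P : probability Omega R.
Variable X : R -> {RV P >-> R}.
Hypothesis X_levy : levy_process X.
Local Notation mu := (@lebesgue_measure R).

Lemma increments_indep (s t : R) (A B : set R) : 0 <= s -> 0 <= t ->
  measurable A -> measurable B ->
  P ((increment X 0 t @^-1` A) `&` (increment X t (t + s) @^-1` B)) =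
  (P (X t @^-1` A) * P (X s @^-1` B))%E.
Proof.
move=> s0 t0 mA mB.
pose u n := match n with 0%N => 0 | 1%N => t | _ => t + s end : R.
pose C n := match n with 0%N => A | _ => B end : set R.
have := @levy_independent _ _ _ _ _ X_levy u 2%N C (lexx 0).
rewrite bigcap_mkord !big_ord_recl !big_ord0 /= setIT mule1 => ->.
- rewrite (levy_stationary X_levy)// subr0 (levy_stationary X_levy)//; last by rewrite lerDl.
  by rewrite addrC addKr.
- move=> [|[|i]] [|[|j]]//= _; rewrite ?lexx// ?lerDl// addr_ge0//.
- by move=> [|i].
Qed.

(** The pair of increments has a law that agrees with a product measure on
    rectangles, hence is that product measure. *)
Lemma semigroup_ge0 (F : R -> \bar R) (s t : R) : 0 <= s -> 0 <= t ->
  measurable_fun [set: R] F -> (forall x, (0 <= F x)%E) ->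
  (\int[P]_w F (X (t + s)%R w) = \int[P]_w \int[P]_v F (X t w + X s v)%R)%E.
Proof.
move=> s0 t0 mF F0.
have mi a b : measurable_fun setT (increment X a b : Omega -> R).
  by apply: measurable_funB; exact: measurable_funPT.
pose phi w : R * R := (increment X 0 t w, increment X t (t + s) w).
have mphi : measurable_fun setT phi by apply: measurable_fun_pair; exact: mi.
have mFp : measurable_fun [set: R * R] (fun z : R * R => F (z.1 + z.2)%R).
  apply: measurableT_comp => //; apply: measurable_funD => //.
transitivity (\int[P]_w (F (increment X 0 t w + increment X t (t + s) w)%R))%E.
  apply: ae_eq_integral => //.
  - by apply: measurableT_comp => //; exact: measurable_funPT.
  - by apply: measurableT_comp => //; apply: measurable_funD; exact: mi.
  apply: filterS (start0 X_levy) => w hw _.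
  by rewrite /increment hw subr0 addrCA subrr addr0.
rewrite -[LHS](@ge0_integral_pushforward _ _ _ (R * R)%type R _ mphi P setT (fun z => F (z.1 + z.2)%R))//.
transitivity (\int[distribution P (X t) \x distribution P (X s)]_z F (z.1 + z.2)%R)%E.
  pose m1 : probability R R := distribution P (X t).
  pose m2 : probability R R := distribution P (X s).
  apply: (@eq_measure_integral _ (R * R)%type R setT (m1 \x m2)%E) => // A mA _; apply/esym.
  apply: product_measure_unique => // {mA}A B mA mB.
  exact: increments_indep.
rewrite fubini_tonelli1// ge0_integral_distribution//; last 2 first.
- exact: measurable_fun_fubini_tonelli_F.
- by move=> y; exact: integral_ge0.
apply: eq_integral => w _; rewrite /fubini_F /=.
rewrite ge0_integral_distribution//=.
by apply: measurableT_comp => //; exact: measurable_funD.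
Qed.

End semigroup.

(** * Bounded measurable functions and their means after one step *)

Section bounded_measurable.
Context {d : measure_display} {T : measurableType d} {R : realType}.
Implicit Types f g : T -> R.

Definition bounded_mfun f :=
  measurable_fun [set: T] f /\ exists M : R, forall x, `|f x| <= M.

Lemma bounded_mfunD f g : bounded_mfun f -> bounded_mfun g ->
  bounded_mfun (fun x => f x + g x).
Proof.
move=> [mf [M fM]] [mg [N gN]]; split; first exact: measurable_funD.
by exists (M + N) => x; rewrite (le_trans (ler_normD _ _))// lerD.
Qed.

Lemma bounded_mfunM f g : bounded_mfun f -> bounded_mfun g ->
  bounded_mfun (fun x => f x * g x).
Proof.
move=> [mf [M fM]] [mg [N gN]]; split; first exact: measurable_funM.
by exists (M * N) => x; rewrite normrM ler_pM.
Qed.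

Lemma bounded_mfun_cst (c : R) : bounded_mfun (fun=> c).
Proof. by split=> //; exists `|c|. Qed.

Lemma bounded_mfunZ (c : R) f : bounded_mfun f -> bounded_mfun (fun x => c * f x).
Proof. by move=> ?; apply: bounded_mfunM => //; exact: bounded_mfun_cst. Qed.

Lemma bounded_mfunN f : bounded_mfun f -> bounded_mfun (fun x => - f x).
Proof.
move=> [mf [M fM]]; split; first exact: measurable_funN.
by exists M => x; rewrite normrN.
Qed.

Lemma bounded_mfunB f g : bounded_mfun f -> bounded_mfun g ->
  bounded_mfun (fun x => f x - g x).
Proof. by move=> hf hg; apply: bounded_mfunD => //; exact: bounded_mfunN. Qed.

Lemma bounded_mfun_indic (A : set T) : measurable A -> bounded_mfun (\1_A : T -> R).
Proof.
move=> mA; split; first exact: measurable_indic.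
by exists 1 => x; rewrite ger0_norm// indicE; case: (_ \in _).
Qed.

Lemma bounded_mfun_integrable (m : {finite_measure set T -> \bar R}) D f :
  measurable D -> bounded_mfun f -> m.-integrable D (EFin \o f).
Proof.
move=> mD [mf [M fM]]; apply: measurable_bounded_integrable => //.
- by apply: (le_lt_trans (le_measure _ _ _ (@subsetT _ D)));
    rewrite ?inE// -ge0_fin_numE// fin_num_measure.
- exact: measurable_funTS.
- exists M; split; first by rewrite num_real.
  by move=> x Mx y _; apply: (le_trans (fM y)); exact: ltW.
Qed.

Lemma integrable_bounded_mfunM (m : {measure set T -> \bar R}) D f g :
  measurable D -> bounded_mfun f -> m.-integrable D (EFin \o g) ->
  m.-integrable D (EFin \o (fun x => f x * g x)).
Proof.
move=> mD [mf [M fM]] ig.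
apply: (@le_integrable _ _ _ _ _ _ _ (fun x => (M * g x)%:E)) => //.
- apply/measurable_EFinP; apply: measurable_funM; first exact: measurable_funTS.
  by apply/measurable_EFinP; exact: measurable_int ig.
- move=> x _; rewrite lee_fin !normrM ler_wpM2r// (le_trans (fM x))//.
  exact: ler_norm.
- by under eq_fun do rewrite EFinM; exact: integrableZl.
Qed.

End bounded_measurable.

Section mean_after_step.
Context {R : realType} {d : measure_display} {Omega : measurableType d}.
Variable P : probability Omega R.
Variable X : R -> {RV P >-> R}.
Hypothesis X_levy : levy_process X.
Local Notation mu := (@lebesgue_measure R).

Definition translate_mean (t : R) (F : R -> R) (y : R) : R :=
  \int[P]_w F (y + X t w).

(** The version of Tonelli's theorem over a measurable set of times, reduced to
    the product of the full spaces by extending the integrand by [0]. *)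
Lemma tonelli_on (D : set R) (g : Omega * R -> \bar R) : measurable D ->
  measurable_fun setT g -> (forall z, (0 <= g z)%E) ->
  (\int[P]_w \int[mu]_(t in D) g (w, t) = \int[mu]_(t in D) \int[P]_w g (w, t))%E.
Proof.
move=> mD mg g0.
have mgD : measurable_fun setT (g \_ (setT `*` D)).
  apply/(measurable_restrictT _ _).1; first exact: measurableX.
  exact: measurable_funTS.
have gD0 z : (0 <= (g \_ (setT `*` D)) z)%E by exact: erestrict_ge0.
have gDE w t : (g \_ (setT `*` D)) (w, t) = ((fun t => g (w, t)) \_ D) t.
  rewrite !patchE; congr (if _ then _ else _); rewrite in_setX in_setT //.
transitivity (\int[P]_w \int[mu]_t (g \_ (setT `*` D)) (w, t))%E.
  by apply: eq_integral => w _; rewrite integral_mkcond; apply: eq_integral => t _; rewrite gDE.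
rewrite fubini_tonelli// [RHS]integral_mkcond; apply: eq_integral => t _.
rewrite patchE; case: ifPn => tD.
  by apply: eq_integral => w _; rewrite gDE patchE tD.
by apply: integral0_eq => w _; rewrite gDE patchE (negbTE tD).
Qed.

Lemma bounded_mfun_path (F : R -> R) (y t : R) : bounded_mfun F ->
  bounded_mfun (fun w => F (y + X t w)).
Proof.
move=> [mF [M FM]]; split; last by exists M.
apply: measurableT_comp => //.
by apply: measurable_funD => //; exact: measurable_funPT.
Qed.

Lemma EFin_translate_mean t F y : bounded_mfun F ->
  (translate_mean t F y)%:E = (\int[P]_w (F (y + X t w))%:E)%E.
Proof.
move=> bF; rewrite fineK//; apply: integrable_fin_num => //.
by apply: bounded_mfun_integrable => //; exact: bounded_mfun_path.
Qed.

Lemma translate_mean_le t F y M : bounded_mfun F -> (forall x, F x <= M) ->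
  translate_mean t F y <= M.
Proof.
move=> bF FM; rewrite -lee_fin EFin_translate_mean//.
apply: (@le_trans _ _ (\int[P]_w (cst M%:E w))%E).
  apply: le_integral => //.
  - by apply: bounded_mfun_integrable => //; exact: bounded_mfun_path.
  - exact: finite_measure_integrable_cst.
  - by move=> w _; rewrite lee_fin.
by rewrite integral_cst//= probability_setT mule1.
Qed.

Lemma translate_mean_ge0 t F y : (forall x, 0 <= F x) -> 0 <= translate_mean t F y.
Proof. by move=> F0; exact: Rintegral_ge0. Qed.

Lemma measurable_translate_mean_space t F : bounded_mfun F -> (forall x, 0 <= F x) ->
  measurable_fun setT (translate_mean t F).
Proof.
move=> [mF bF] F0; apply/measurable_EFinP.
rewrite (_ : EFin \o _ = fun y => \int[P]_w (F (y + X t w))%:E)%E; last first.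
  by apply/funext => y; rewrite /= EFin_translate_mean.
apply: (@measurable_fun_fubini_tonelli_F _ _ R Omega R P (fun z => (F (z.1 + X t z.2))%:E)) => //.
- apply/measurable_EFinP; apply: measurableT_comp => //; apply: measurable_funD => //.
  by apply: measurableT_comp => //; exact: measurable_funPT.
- by move=> z; rewrite lee_fin.
Qed.

Lemma measurable_translate_mean_time (F : R -> R) : bounded_mfun F -> (forall x, 0 <= F x) ->
  measurable_fun setT (fun t : R => translate_mean (Num.max 0 t) F 0).
Proof.
move=> [mF bF] F0; apply/measurable_EFinP.
rewrite (_ : EFin \o _ = fun t => \int[P]_w (F (X (Num.max 0 t) w))%:E)%E; last first.
  apply/funext => y; rewrite /= EFin_translate_mean//.
  by apply: eq_integral => w _; rewrite add0r.
apply: (@measurable_fun_fubini_tonelli_G _ _ Omega R R P (fun z => (F (X (Num.max 0 z.2) z.1))%:E)) => //.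
- apply/measurable_EFinP; apply: measurableT_comp => //; exact: measurable_path.
- by move=> z; rewrite lee_fin.
Qed.

End mean_after_step.

(** * The resolvent density *)

Section resolvent.
Context {R : realType} {d : measure_display} {Omega : measurableType d}.
Variable P : probability Omega R.
Variable X : R -> {RV P >-> R}.
Hypothesis X_levy : levy_process X.
Local Notation mu := (@lebesgue_measure R).

Lemma integral_indicM (A : set R) (g : R -> R) :
  (\int[mu]_x (\1_A x * g x)%:E = \int[mu]_(x in A) (g x)%:E)%E.
Proof.
rewrite [RHS]integral_mkcond; apply: eq_integral => x _.
by rewrite patchE indicE; case: (x \in A); rewrite ?mul1r ?mul0r.
Qed.

Lemma measurable_expR_decay (q : R) : measurable_fun [set: R] (fun t => expR (- (q * t))).
Proof.
by apply: measurableT_comp => //; apply: measurableT_comp => //; exact: measurable_funM.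
Qed.

Lemma integral_expR_decay (q : R) : 0 < q ->
  (\int[mu]_(t in `[0%R, +oo[) (expR (- (q * t)))%:E = q^-1%:E)%E.
Proof.
move=> q0; have := integral_exponential_pdf q0.
rewrite (_ : (fun x => _) = (fun t => (q * expR (- (q * t)))%:E) \_ `[0, +oo[); last first.
  apply/funext => x; rewrite /exponential_pdf !patchE; case: ifP => // _.
  by rewrite mulNr.
rewrite -integral_mkcond; under eq_integral do rewrite EFinM.
rewrite ge0_integralZl//; last 2 first.
- apply/measurable_EFinP; apply: measurable_funTS; exact: measurable_expR_decay.
- by rewrite lee_fin ltW.
move=> h; rewrite -[LHS]mul1e -[in LHS](@mulVf _ q) ?gt_eqF// EFinM -muleA h.
by rewrite mule1.
Qed.

Section density.
Variables (q : R) (r : R -> R).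
Hypotheses (q0 : 0 < q) (hr : resolvent_density X q r).

Definition potential (F : R -> R) := \int[mu]_x (F x * r x).

Lemma resolvent_continuous : continuous r.
Proof. by have [] := hr. Qed.

Lemma resolvent_bounded_mfun : bounded_mfun r.
Proof.
split; first exact: continuous_measurable_fun resolvent_continuous.
have [[M [_ hM]] _ _] := hr; exists (M + 1) => x.
by apply: (hM (M + 1)) => //; rewrite ltrDl.
Qed.

(** If [r] were negative at a point, it would be so on a ball, and the ball
    would have a negative occupation time. *)
Lemma resolvent_ge0 x : 0 <= r x.
Proof.
rewrite leNgt; apply/negP => rx.
have [e /= e0 he] : exists2 e, 0 < e & forall y, ball x e y -> r y <= r x / 2.
  have /cvgrPdist_lt /(_ (- (r x / 2)))[|e e0 he] := @resolvent_continuous x.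
    by lra.
  exists e => // y /he.
  by rewrite ltr_norml => /andP[+ _]; lra.
have mB : measurable (ball x e) by exact: measurable_ball.
have Bfin : (mu (ball x e) < +oo)%E by rewrite lebesgue_measure_ball ?ltry ?ltW.
have [_ _ /(_ (\1_(ball x e)) (measurable_indic mB))] := hr.
move=> /(_ (fun x => ltac:(by rewrite indicE))); rewrite integral_indicM => hE.
have : (0 <= \int[mu]_(y in ball x e) (r y)%:E)%E.
  rewrite hE; apply: integral_ge0 => w _; apply: integral_ge0 => t _.
  by rewrite lee_fin mulr_ge0 ?expR_ge0// indicE.
apply/negP; rewrite -ltNge.
apply: (@le_lt_trans _ _ (\int[mu]_(y in ball x e) (cst (r x / 2)%:E) y)%E).
  apply: le_integral => //.
  - have [mr [M rM]] := resolvent_bounded_mfun.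
    apply: measurable_bounded_integrable => //; first exact: measurable_funTS.
    exists M; split; first by rewrite num_real.
    by move=> z Mz y _; apply: (le_trans (rM y)); exact: ltW.
  - apply: (@measurable_bounded_integrable _ _ _ _ (cst (r x / 2))) => //.
    exists `|r x / 2|; split; first by rewrite num_real.
    by move=> z zM y _; exact: ltW.
  - by move=> y; rewrite inE => /he; rewrite lee_fin.
rewrite integral_cst//= lebesgue_measure_ball ?ltW// -EFinM lte_fin.
by rewrite pmulr_llt0 ?mulrn_wgt0//; lra.
Qed.

End density.
End resolvent.

(** * The resolvent identity *)

Section resolvent_identity.
Context {R : realType} {d : measure_display} {Omega : measurableType d}.
Variable P : probability Omega R.
Variable X : R -> {RV P >-> R}.
Hypothesis X_levy : levy_process X.
Local Notation mu := (@lebesgue_measure R).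

(** The Markov property at time [t], as an identity between means. *)
Lemma translate_mean_semigroup (s t : R) (F : R -> R) : 0 <= s -> 0 <= t ->
  bounded_mfun F -> (forall x, 0 <= F x) ->
  translate_mean X (t + s) F 0 = translate_mean X t (translate_mean X s F) 0.
Proof.
move=> s0 t0 bF F0; rewrite /translate_mean /Rintegral; congr fine.
under eq_integral do rewrite add0r.
rewrite (semigroup_ge0 X_levy (F := EFin \o F))//; last first.
  by apply/measurable_EFinP; have [] := bF.
apply: eq_integral => w _; rewrite add0r.
by rewrite -[RHS]/((translate_mean X s F (X t w))%:E) EFin_translate_mean.
Qed.

Lemma bounded_mfun_translate_mean (s : R) (F : R -> R) :
  bounded_mfun F -> (forall x, 0 <= F x) -> bounded_mfun (translate_mean X s F).
Proof.
move=> bF F0; split; first exact: measurable_translate_mean_space.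
have [_ [M FM]] := bF; exists M => x.
rewrite ger0_norm ?translate_mean_ge0// translate_mean_le// => y.
by rewrite (le_trans (ler_norm _)).
Qed.

Section density.
Variables (q : R) (r : R -> R).
Hypotheses (q0 : 0 < q) (hr : resolvent_density X q r).

Lemma resolvent_mass : (\int[mu]_x (r x)%:E = q^-1%:E)%E.
Proof.
have [_ _ /(_ (cst 1) (measurable_cst _) (fun=> ler01))] := hr.
under eq_integral do rewrite mul1r.
move=> ->; under eq_integral do under eq_integral do rewrite mulr1.
under eq_integral do rewrite integral_expR_decay//.
by rewrite integral_cst//= probability_setT mule1.
Qed.

Lemma resolvent_integrable : mu.-integrable setT (EFin \o r).
Proof.
apply/integrableP; split.
  by apply/measurable_EFinP; have [] := resolvent_bounded_mfun hr.
under eq_integral => x _ do rewrite /= (ger0_norm (resolvent_ge0 hr x)).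
by rewrite resolvent_mass ltry.
Qed.

Lemma potential_integrable F : bounded_mfun F ->
  mu.-integrable setT (EFin \o (fun x => F x * r x)).
Proof. by move=> bF; apply: integrable_bounded_mfunM => //; exact: resolvent_integrable. Qed.

Lemma EFin_potential F : bounded_mfun F ->
  (potential r F)%:E = (\int[mu]_x (F x * r x)%:E)%E.
Proof.
by move=> bF; rewrite fineK//; apply: integrable_fin_num => //; exact: potential_integrable.
Qed.

Lemma potentialD F H : bounded_mfun F -> bounded_mfun H ->
  potential r (fun x => F x + H x) = potential r F + potential r H.
Proof.
move=> bF bH; rewrite /potential -RintegralD//; [|exact: potential_integrable..].
by apply: eq_Rintegral => x _; rewrite mulrDl.
Qed.

Lemma potentialZ c F : bounded_mfun F ->
  potential r (fun x => c * F x) = c * potential r F.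
Proof.
move=> bF; rewrite /potential -RintegralZl//; last exact: potential_integrable.
by apply: eq_Rintegral => x _; rewrite mulrA.
Qed.

Lemma potential_cst c : potential r (fun=> c) = c / q.
Proof.
rewrite /potential RintegralZl//; last exact: resolvent_integrable.
by rewrite /Rintegral resolvent_mass.
Qed.

Lemma le_potential F H : bounded_mfun F -> bounded_mfun H ->
  (forall x, F x <= H x) -> potential r F <= potential r H.
Proof.
move=> bF bH FH; apply: le_Rintegral => //; [exact: potential_integrable..|].
by move=> x _; rewrite ler_wpM2r// (resolvent_ge0 hr).
Qed.

Lemma potential_le_cst F M : bounded_mfun F -> (forall x, `|F x| <= M) ->
  `|potential r F| <= M / q.
Proof.
move=> bF FM; rewrite ler_norml; apply/andP; split.
  rewrite -mulNr -potential_cst; apply: le_potential => //; first exact: bounded_mfun_cst.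
  by move=> x; have := FM x; rewrite ler_norml => /andP[].
rewrite -potential_cst; apply: le_potential => //; first exact: bounded_mfun_cst.
by move=> x; have := FM x; rewrite ler_norml => /andP[].
Qed.

Lemma measurable_occupation F : bounded_mfun F -> (forall x, 0 <= F x) ->
  measurable_fun setT (fun t => expR (- (q * t)) * translate_mean X (Num.max 0 t) F 0).
Proof.
move=> bF F0; apply: measurable_funM; first exact: measurable_expR_decay.
exact: measurable_translate_mean_time.
Qed.

Lemma potential_time F : bounded_mfun F -> (forall x, 0 <= F x) ->
  (potential r F)%:E =
  (\int[mu]_(t in `[0%R, +oo[) (expR (- (q * t)) * translate_mean X t F 0)%:E)%E.
Proof.
move=> bF F0; have mF : measurable_fun setT F by have [] := bF.
rewrite EFin_potential//; have [_ _ ->//] := hr.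
transitivity (\int[P]_w \int[mu]_(t in `[0%R, +oo[)
    (expR (- (q * t)) * F (X (Num.max 0 t) w))%:E)%E.
  apply: eq_integral => w _; apply: eq_integral => t.
  by rewrite inE/= in_itv/= andbT => t0; rewrite (max_idPr t0).
rewrite (@tonelli_on _ _ _ P _ (fun z => (expR (- (q * z.2)) * F (X (Num.max 0 z.2) z.1))%:E))//=.
- apply: eq_integral => t; rewrite inE/= in_itv/= andbT => t0; rewrite (max_idPr t0).
  under eq_integral do rewrite EFinM.
  rewrite ge0_integralZl//=; last 2 first.
  + by apply/measurable_EFinP; apply: measurableT_comp => //; exact: measurable_funPT.
  + by move=> w _; rewrite lee_fin.
  rewrite EFinM EFin_translate_mean//; congr (_ * _)%E.
  by apply: eq_integral => w _; rewrite add0r.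
- apply/measurable_EFinP; apply: measurable_funM.
    by apply: (@measurableT_comp _ _ _ _ _ _ (fun t => expR (- (q * t)))) => //; exact: measurable_expR_decay.
  by apply: measurableT_comp => //; exact: measurable_path.
- by move=> z; rewrite lee_fin mulr_ge0// expR_ge0.
Qed.

Definition initial_occupation (s : R) (F : R -> R) : R :=
  \int[mu]_(t in `[0, s[) (expR (- (q * t)) * translate_mean X t F 0).

Lemma initial_occupation_integrable s F : bounded_mfun F -> (forall x, 0 <= F x) ->
  mu.-integrable `[0, s[ (fun t => (expR (- (q * t)) * translate_mean X t F 0)%:E).
Proof.
move=> bF F0; apply: (@eq_integrable _ _ _ mu _ _ (fun t : R =>
    (expR (- (q * t)) * translate_mean X (Num.max 0 t) F 0)%:E)) => //.
  by move=> t; rewrite inE/= in_itv/= => /andP[t0 _]; rewrite (max_idPr t0).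
have [_ [M FM]] := bF.
apply: measurable_bounded_integrable => //.
- by rewrite /= lebesgue_measure_itv/=; case: ifP => // _; rewrite ltry.
- by apply: measurable_funTS; exact: measurable_occupation.
- exists M; split; first by rewrite num_real.
  move=> z Mz t; rewrite /= in_itv/= => /andP[t0 _]; apply: le_trans (ltW Mz).
  rewrite (max_idPr t0) ger0_norm ?mulr_ge0 ?expR_ge0 ?translate_mean_ge0//.
  rewrite -[leRHS]mul1r ler_pM ?expR_ge0 ?translate_mean_ge0//.
    by rewrite -expR0 ler_expR oppr_le0 mulr_ge0// ltW.
  by rewrite translate_mean_le// => y; rewrite (le_trans (ler_norm _)).
Qed.

(** The time integral is cut at [s]; the Markov property turns the part after
    [s] into the same integral for the function [translate_mean X s F]. *)
Lemma resolvent_identity_ge0 s F : 0 <= s -> bounded_mfun F -> (forall x, 0 <= F x) ->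
  potential r F = initial_occupation s F + expR (- (q * s)) * potential r (translate_mean X s F).
Proof.
move=> s0 bF F0; apply: EFin_inj; rewrite EFinD EFinM.
have bG := bounded_mfun_translate_mean s bF F0.
have G0 x : 0 <= translate_mean X s F x by exact: translate_mean_ge0.
pose g t := (expR (- (q * t)) * translate_mean X (Num.max 0 t) F 0)%:E.
have g0 t : (0 <= g t)%E by rewrite lee_fin mulr_ge0 ?expR_ge0 ?translate_mean_ge0.
have mg : measurable_fun setT g by apply/measurable_EFinP; exact: measurable_occupation.
have gE t : 0 <= t -> (expR (- (q * t)) * translate_mean X t F 0)%:E = g t.
  by move=> t0; rewrite /g (max_idPr t0).
rewrite !potential_time//.
transitivity (\int[mu]_(t in `[0%R, +oo[) g t)%E.
  by apply: eq_integral => t; rewrite inE/= in_itv/= andbT => /gE.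
transitivity (\int[mu]_(t in `[0%R, s[ `|` `[s, +oo[) g t)%E.
  by rewrite -itv_bndbnd_setU//= bnd_simp.
rewrite ge0_integral_setU//; last 2 first.
- exact: measurable_funTS.
- apply/disj_setPS => t [] /=; rewrite !in_itv/= andbT => /andP[_ ts] st.
  by have := lt_le_trans ts st; rewrite ltxx.
congr (_ + _)%E.
  rewrite /initial_occupation fineK; last first.
    by apply: integrable_fin_num => //; exact: initial_occupation_integrable.
  by apply: eq_integral => t; rewrite inE/= in_itv/= => /andP[/gE ->].
have mgs : measurable_fun setT (g \_ `[s, +oo[).
  by apply/(measurable_restrictT _ _).1 => //; exact: measurable_funTS.
rewrite integral_mkcond -(ge0_integral_shift s)//; last first.
  by move=> x; apply: erestrict_ge0.
transitivity (\int[mu]_(t in `[0%R, +oo[) g (t + s)%R)%E.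
  rewrite [RHS]integral_mkcond; apply: eq_integral => t _; rewrite !patchE.
  congr (if _ then _ else _); apply/idP/idP; rewrite !inE/= !in_itv/= !andbT;
    by rewrite lerDr.
rewrite -ge0_integralZl//=; last 2 first.
- apply: (@eq_measurable_fun _ _ _ _ _ (fun t : R =>
    (expR (- (q * t)) * translate_mean X (Num.max 0 t) (translate_mean X s F) 0)%:E)).
    by move=> t; rewrite inE/= in_itv/= andbT => t0; rewrite (max_idPr t0).
  by apply/measurable_EFinP; apply: measurable_funTS; exact: measurable_occupation.
- by move=> t _; rewrite lee_fin mulr_ge0 ?expR_ge0 ?translate_mean_ge0.
apply: eq_integral => t; rewrite inE/= in_itv/= andbT => t0.
rewrite /g (max_idPr (addr_ge0 t0 s0)) -EFinM translate_mean_semigroup//.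
by rewrite mulrA -expRD mulrDr opprD addrC.
Qed.

End density.
End resolvent_identity.

(** * The domination principle *)

Section domination.
Context {R : realType} {d : measure_display} {Omega : measurableType d}.
Variable P : probability Omega R.
Variable X : R -> {RV P >-> R}.
Hypothesis X_levy : levy_process X.
Local Notation mu := (@lebesgue_measure R).
Variables (q : R) (r : R -> R).
Hypotheses (q0 : 0 < q) (hr : resolvent_density X q r).

Definition resolvent_op (F : R -> R) (x : R) : R := potential r (fun y => F (x + y)).

Lemma bounded_mfun_shiftl (F : R -> R) (c : R) : bounded_mfun F ->
  bounded_mfun (fun x : R => F (c + x)).
Proof.
move=> [mF [M FM]]; split; last by exists M.
by apply: measurableT_comp => //; exact: measurable_funD.
Qed.

Lemma bounded_mfun_resolvent_op (F : R -> R) : bounded_mfun F -> (forall x, 0 <= F x) ->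
  bounded_mfun (resolvent_op F).
Proof.
move=> bF F0; split.
  apply/measurable_EFinP.
  rewrite (_ : EFin \o _ = fun x => \int[mu]_y (F (x + y) * r y)%:E)%E; last first.
    apply/funext => x; rewrite /= (EFin_potential _ hr)//.
    exact: bounded_mfun_shiftl.
  have [mF _] := bF; have [mr _] := resolvent_bounded_mfun hr.
  pose f (z : R * R) := (F (z.1 + z.2) * r z.2)%:E.
  apply: (@measurable_fun_fubini_tonelli_F _ _ _ _ _ mu f) => //.
  - apply/measurable_EFinP; apply: measurable_funM.
      by apply: measurableT_comp => //; exact: measurable_funD.
    exact: measurableT_comp.
  - by move=> z; rewrite lee_fin mulr_ge0// (resolvent_ge0 hr).
have [_ [M FM]] := bF; exists (M / q) => x.
by apply: (potential_le_cst q0 hr) => //; exact: bounded_mfun_shiftl.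
Qed.

(** The resolvent commutes with the semigroup, as both are convolutions. *)
Lemma potential_translate_mean s (F : R -> R) x : bounded_mfun F -> (forall x, 0 <= F x) ->
  potential r (translate_mean X s (fun y => F (x + y))) =
  translate_mean X s (resolvent_op F) x.
Proof.
move=> bF F0; apply: EFin_inj.
have bFx y : bounded_mfun (fun z : R => F (y + z)) by exact: bounded_mfun_shiftl.
have r0 := resolvent_ge0 hr.
have [mF _] := bF; have [mr _] := resolvent_bounded_mfun hr.
rewrite (EFin_potential q0 hr)//; last by apply: bounded_mfun_translate_mean.
rewrite EFin_translate_mean//; last exact: bounded_mfun_resolvent_op.
pose f (z : R * Omega) := (F (x + (z.1 + X s z.2)) * r z.1)%:E.
transitivity (\int[mu]_y \int[P]_w f (y, w))%E.
  apply: eq_integral => y _; rewrite /f /=; under [RHS]eq_integral do rewrite mulrC EFinM.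
  rewrite ge0_integralZl//=.
  - by rewrite mulrC EFinM EFin_translate_mean.
  - apply/measurable_EFinP; apply: measurableT_comp => //; apply: measurable_funD => //.
    by apply: measurable_funD => //; exact: measurable_funPT.
  - by move=> w _; rewrite lee_fin.
  - by rewrite lee_fin.
rewrite fubini_tonelli//; last 2 first.
- apply/measurable_EFinP; apply: measurable_funM; last exact: measurableT_comp.
  apply: measurableT_comp => //; apply: measurable_funD => //; apply: measurable_funD => //.
  by apply: measurableT_comp => //; exact: measurable_funPT.
- by move=> z; rewrite lee_fin mulr_ge0.
apply: eq_integral => w _; rewrite (EFin_potential q0 hr)//.
by apply: eq_integral => y _; rewrite /f /= (addrC y) addrA.
Qed.

Lemma resolvent_op_identity s (F : R -> R) x : 0 <= s -> bounded_mfun F -> (forall x, 0 <= F x) ->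
  resolvent_op F x = initial_occupation X q s (fun y => F (x + y)) +
    expR (- (q * s)) * translate_mean X s (resolvent_op F) x.
Proof.
move=> s0 bF F0; rewrite -potential_translate_mean//.
by apply: (resolvent_identity_ge0 X_levy) => //; exact: bounded_mfun_shiftl.
Qed.

Lemma initial_occupation_ge0 s F : (forall x, 0 <= F x) ->
  0 <= initial_occupation X q s F.
Proof.
by move=> F0; apply: Rintegral_ge0 => t _; rewrite mulr_ge0 ?expR_ge0// translate_mean_ge0.
Qed.

Lemma initial_occupation_le s F c : 0 <= s -> bounded_mfun F -> (forall x, 0 <= F x) ->
  (forall t, 0 <= t <= s -> translate_mean X t F 0 <= c) ->
  initial_occupation X q s F <= c * s.
Proof.
move=> s0 bF F0 Fc.
have c0 : 0 <= c by rewrite (le_trans _ (Fc 0 _)) ?lexx ?s0// translate_mean_ge0.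
apply: (@le_trans _ _ (\int[mu]_(t in `[0, s[) c)).
  apply: le_Rintegral => //.
  - exact: (initial_occupation_integrable X_levy).
  - apply: measurable_bounded_integrable => //.
      by rewrite /= lebesgue_measure_itv/=; case: ifP => // _; rewrite ltry.
    exists `|c|; split; first by rewrite num_real.
    by move=> z zM y _; exact: ltW.
  - move=> t; rewrite /= in_itv/= => /andP[t0 ts].
    rewrite -[leRHS]mul1r ler_pM ?expR_ge0 ?translate_mean_ge0//.
      by rewrite -expR0 ler_expR oppr_le0 mulr_ge0// ltW.
    by rewrite Fc// t0 ltW.
rewrite Rintegral_cst//= lebesgue_measure_itv/= lte_fin.
by case: ifPn => //= s1; rewrite ?subr0 ?mulr0// mulr_ge0.
Qed.

(** Let [w] be the excess of the left-hand side over the right-hand side and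
    [M] its supremum, and suppose [M > 0]. The resolvent identity over a time
    [s] bounds [w y] by [exp (- q s) M] plus [c] times the time that the
    process started at [y] spends in [- e, e] before [s]. When [|y| > 2 e], that
    time is [o(s)] by right-continuity at [0], uniformly in [y]; when
    [|y| <= 2 e], [w y <= 0]. Hence [M (1 - exp (- q s)) = o(s)], which is
    absurd. *)
Lemma domination (e c : R) (F : R -> R) : 0 < e -> 0 <= c ->
  bounded_mfun F -> (forall x, 0 <= F x) ->
  (forall x, `|x| <= e *+ 2 -> c * resolvent_op \1_(`[- e, e]) x <= resolvent_op F x) ->
  forall x, c * resolvent_op \1_(`[- e, e]) x <= resolvent_op F x.
Proof.
move=> e0 c0 bF F0 near0 x; set H : R -> R := \1_ _.
have bH : bounded_mfun H by exact: bounded_mfun_indic.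
have H0 y : 0 <= H y by rewrite /H indicE.
pose w y := c * resolvent_op H y - resolvent_op F y.
have bG := bounded_mfun_resolvent_op bF F0.
have bGH := bounded_mfun_resolvent_op bH H0.
have bw : bounded_mfun w by apply: bounded_mfunB => //; exact: bounded_mfunZ.
have [_ [B wB]] := bw.
have hs : has_sup (range w).
  split; first by exists (w 0), 0.
  by exists B => _ [y _ <-]; rewrite (le_trans (ler_norm _)).
have wsup y : w y <= sup (range w) by apply: sup_ubound; [exact: hs.2 | exists y].
rewrite -subr_le0 -/(w x); rewrite leNgt; apply/negP => wx0.
pose M := sup (range w); have M0 : 0 < M by exact: lt_le_trans wx0 (wsup x).
(* Small enough for [c * delta] to stay below [M * q * expR (- q)], which is
   a lower bound for [M * (1 - expR (- (q * s))) / s] when [s <= 1]. *)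
pose delta := M * q * expR (- q) / (c + 1) / 2.
have delta0 : 0 < delta by rewrite /delta !divr_gt0 ?mulr_gt0 ?expR_gt0// ltr_wpDl.
have [s1 s10 hs1] := prob_small_time X_levy e0 delta0.
pose s := Num.min s1 1.
have s0 : 0 < s by rewrite lt_min s10 ltr01.
have ss1 : s <= s1 by rewrite ge_min lexx.
have sle1 : s <= 1 by rewrite ge_min lexx orbT.
have step y : w y <= c * (delta * s) + expR (- (q * s)) * M.
  have [ye|ye] := leP (`|y|) (e *+ 2).
    rewrite (@le_trans _ _ 0)//; first by rewrite subr_le0 near0.
    apply: addr_ge0; first by apply: mulr_ge0 => //; apply: mulr_ge0; exact: ltW.
    by apply: mulr_ge0; [exact: expR_ge0 | exact: ltW].
  rewrite /w (resolvent_op_identity _ (ltW s0) bH H0) (resolvent_op_identity _ (ltW s0) bF F0).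
  have h1 : initial_occupation X q s (fun z => H (y + z)) <= delta * s.
    apply: initial_occupation_le => //; [exact: ltW|exact: bounded_mfun_shiftl|].
    move=> t /andP[t0 ts]; rewrite -lee_fin EFin_translate_mean; last exact: bounded_mfun_shiftl.
    apply: le_trans (hs1 t _); last by rewrite t0 (le_trans ts).
    have mS : measurable [set w | (e <= `|X t w|)%R].
      rewrite -[X in measurable X]setTI.
      apply: (@measurable_fun_le _ _ _ _ (cst e)) => //; exact: measurableT_comp.
    rewrite -[X in P X]setIT -integral_indic//; apply: ge0_le_integral => //.
    - by move=> v _; rewrite lee_fin.
    - have [mH _] := bH; apply/measurable_EFinP; apply: measurableT_comp => //.
      by apply: measurable_funD => //; apply: measurable_funD => //; exact: measurable_funPT.
    - by apply/measurable_EFinP; exact: measurable_indic.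
    - move=> v _; rewrite lee_fin add0r /H !indicE.
      have [|//] := boolP (_ \in `[- e, e]%classic).
      rewrite inE/= in_itv/= => yX; rewrite (_ : v \in _)// inE/=.
      have := ler_normB (y + X t v) (X t v); rewrite addrK => h.
      have : `|y + X t v| <= e by rewrite ler_norml.
      by move: ye; rewrite mulr2n; lra.
  have h2 := initial_occupation_ge0 s (fun z => F0 (y + z)).
  have h3 : c * translate_mean X s (resolvent_op H) y - translate_mean X s (resolvent_op F) y <= M.
    have -> : c * translate_mean X s (resolvent_op H) y - translate_mean X s (resolvent_op F) y = translate_mean X s w y.
      rewrite /translate_mean /w -RintegralZl//; last first.
        by apply: bounded_mfun_integrable => //; exact: bounded_mfun_path.
      rewrite -RintegralB//.
      - by apply: bounded_mfun_integrable => //; apply: bounded_mfunZ; exact: bounded_mfun_path.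
      - by apply: bounded_mfun_integrable => //; exact: bounded_mfun_path.
    by apply: translate_mean_le.
  have := ler_wpM2l c0 h1; have := ler_wpM2l (expR_ge0 (- (q * s))) h3; lra.
have Mle : M <= c * (delta * s) + expR (- (q * s)) * M.
  by apply: sup_le_ub; [exists (w 0), 0 | move=> _ [y _ <-]].
have h4 : q * s * expR (- q) <= 1 - expR (- (q * s)).
  have h5 : expR (- q) <= expR (- (q * s)).
    by rewrite ler_expR lerN2 ler_piMr// ltW.
  have h6 : q * s * expR (- (q * s)) <= 1 - expR (- (q * s)).
    have := expR_ge1Dx (q * s) => h; have := ler_wpM2r (expR_ge0 (- (q * s))) h.
    by rewrite mulrDl mul1r -expRD subrr expR0; lra.
  apply: le_trans h6; rewrite ler_wpM2l// mulr_ge0// ltW//.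
have h7 : M * (q * s * expR (- q)) <= c * (delta * s).
  have := ler_wpM2l (ltW M0) h4; lra.
have : c * (delta * s) < M * (q * s * expR (- q)).
  rewrite /delta.
  have -> : c * (M * q * expR (- q) / (c + 1) / 2 * s) = (c / (c + 1) / 2) * (M * (q * s * expR (- q))).
    field; rewrite gt_eqF// ltr_wpDl//.
  rewrite -[ltRHS]mul1r ltr_pM2r ?mulr_gt0 ?expR_gt0//.
  rewrite -mulrA -invfM ltr_pdivrMr; last by rewrite mulr_gt0// ltr_wpDl.
  lra.
by rewrite ltNge h7.
Qed.

End domination.

(** * Inequalities for the resolvent density *)

Section density_inequalities.
Context {R : realType} {d : measure_display} {Omega : measurableType d}.
Variable P : probability Omega R.
Variable X : R -> {RV P >-> R}.
Hypothesis X_levy : levy_process X.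
Local Notation mu := (@lebesgue_measure R).
Variables (q : R) (r : R -> R).
Hypotheses (q0 : 0 < q) (hr : resolvent_density X q r).

Let bounded_itv (a b : R) : bounded_mfun (\1_`[a, b] : R -> R).
Proof. exact: bounded_mfun_indic. Qed.

Let itv_ge0 (a b x : R) : 0 <= \1_`[a, b] x :> R.
Proof. by rewrite indicE. Qed.

(** After a change of variable the domain of integration depends neither on the
    center [w] nor on the starting point [x], so that potentials of intervals
    are compared by comparing values of [r]. *)
Lemma resolvent_op_itv (w e x : R) :
  resolvent_op r \1_`[w - e, w + e] x = \int[mu]_(u in `[- e, e]) r (u + (w - x)).
Proof.
have [mr _] := resolvent_bounded_mfun hr.
have r0 := resolvent_ge0 hr.
rewrite /resolvent_op /potential /Rintegral; congr fine.
rewrite -[LHS](ge0_integral_shift (w - x))//.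
- rewrite -[RHS]integral_indicM; apply: eq_integral => u _.
  congr (_ * _)%:E; rewrite !indicE; congr (_%:R); congr (nat_of_bool _).
  by apply/idP/idP; rewrite !inE/= !in_itv/= => /andP[h1 h2]; apply/andP; split; lra.
- apply/measurable_EFinP; apply: measurable_funM => //.
  by have [] := bounded_mfun_shiftl x (bounded_itv (w - e) (w + e)).
- by move=> u; rewrite lee_fin mulr_ge0.
Qed.

Let shifted_integrable (e c : R) : 0 <= e ->
  mu.-integrable `[- e, e] (fun u => (r (u + c))%:E).
Proof.
move=> e0; have [mr [M rM]] := resolvent_bounded_mfun hr.
apply: measurable_bounded_integrable => //.
- by rewrite /= lebesgue_measure_itv/=; case: ifP => // _; rewrite ltry.
- by apply: measurable_funTS; apply: measurableT_comp => //; exact: measurable_funD.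
- exists M; split; first by rewrite num_real.
  by move=> z Mz y _; apply: (le_trans (rM _)); exact: ltW.
Qed.

Let cst_integrable (e c : R) : mu.-integrable `[- e, e] (EFin \o cst c).
Proof.
apply: measurable_bounded_integrable => //.
- by rewrite /= lebesgue_measure_itv/=; case: ifP => // _; rewrite ltry.
- by exists `|c|; split; [rewrite num_real|move=> z Mz y _; exact: ltW].
Qed.

Let Rintegral_itv_cst (e c : R) : 0 < e ->
  \int[mu]_(u in `[- e, e]) c = c * (e *+ 2).
Proof.
move=> e0; rewrite Rintegral_cst//= lebesgue_measure_itv/= lte_fin gtrN//=.
by rewrite opprK mulr2n.
Qed.

Lemma resolvent_op_itv_le (w e x K : R) : 0 < e ->
  (forall u, `|u| <= e -> r (u + (w - x)) <= K) ->
  resolvent_op r \1_`[w - e, w + e] x <= K * (e *+ 2).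
Proof.
move=> e0 rK; rewrite resolvent_op_itv -Rintegral_itv_cst//.
apply: le_Rintegral => //; first by apply: shifted_integrable; exact: ltW.
  exact: cst_integrable.
by move=> u; rewrite /= in_itv/= => h; rewrite rK// ler_norml.
Qed.

Lemma resolvent_op_itv_ge (w e x K : R) : 0 < e ->
  (forall u, `|u| <= e -> K <= r (u + (w - x))) ->
  K * (e *+ 2) <= resolvent_op r \1_`[w - e, w + e] x.
Proof.
move=> e0 rK; rewrite resolvent_op_itv -Rintegral_itv_cst//.
apply: le_Rintegral => //; last by move=> u; rewrite /= in_itv/= => h; rewrite rK// ler_norml.
  exact: cst_integrable.
by apply: shifted_integrable; exact: ltW.
Qed.

Let oscillation (p delta : R) : 0 < delta ->
  exists2 e : R, 0 < e & forall v, `|v| <= e *+ 3 ->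
    r p - delta <= r (v + p) /\ r (v + p) <= r p + delta.
Proof.
move=> delta0; have /cvgrPdist_le /(_ _ delta0)[e /= e0 he] := @resolvent_continuous _ _ _ _ _ _ _ hr p.
exists (e / 4); first by rewrite divr_gt0.
move=> v hv; suff : `|r p - r (v + p)| <= delta.
  by rewrite ler_norml => /andP[? ?]; split; lra.
apply: he => /=.
rewrite opprD addrCA subrr addr0 normrN (le_lt_trans hv)//.
by rewrite -mulrnAl ltr_pdivrMr// -mulr_natr ltr_pM2l// ltr_nat.
Qed.

(** The domination principle compares the potential of a small interval around
    [0] with that of the interval of same length around [b]: near [0] their
    ratio is about [r 0 / r b], and at the point [- a] it is about
    [r a / r (a + b)]. The error [delta] made by replacing [r] by its values
    at the four points [0], [a], [b] and [a + b] costs at most [delta * K]. *)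
Lemma resolvent_mul_le (a b : R) : r a * r b <= r 0 * r (a + b).
Proof.
have r0 := resolvent_ge0 hr.
have [rb0|rb0] := leP (r b) 0.
  by rewrite (le_anti (introT andP (conj rb0 (r0 b)))) mulr0 mulr_ge0.
pose K := r 0 + r a + r b + r (a + b).
have K0 : 0 < K by rewrite /K ltr_wpDr// ltr_wpDl// addr_ge0.
suff small (delta : R) : 0 < delta -> delta < r b -> r a * r b <= r 0 * r (a + b) + delta * K.
  rewrite leNgt; apply/negP => h.
  pose delta := Num.min (r b / 2) ((r a * r b - r 0 * r (a + b)) / K / 2).
  have d0 : 0 < delta by rewrite lt_min !divr_gt0// subr_gt0.
  have /(_ _)/le_trans := small _ d0.
  have h1 : delta < r b by rewrite gt_min; apply/orP; left; lra.
  have h2 : delta * K <= (r a * r b - r 0 * r (a + b)) / 2.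
    rewrite -ler_pdivlMr// [X in _ <= X]mulrAC ge_min; apply/orP; right.
    by rewrite mulrAC.
  by have := small _ d0 h1; lra.
move=> delta0 deltab.
have [e1 e10 h1] := oscillation 0 delta0.
have [e2 e20 h2] := oscillation b delta0.
have [e3 e30 h3] := oscillation a delta0.
have [e4 e40 h4] := oscillation (a + b) delta0.
pose e := Num.min (Num.min e1 e2) (Num.min e3 e4).
have e0 : 0 < e by rewrite !lt_min e10 e20 e30 e40.
have le1 : e <= e1 by rewrite !ge_min lexx.
have le2 : e <= e2 by rewrite !ge_min lexx orbT.
have le3 : e <= e3 by rewrite !ge_min lexx !orbT.
have le4 : e <= e4 by rewrite !ge_min lexx !orbT.
pose c := (r b - delta) / (r 0 + delta).
have A0 : 0 < r 0 + delta by rewrite ltr_wpDl.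
have c0 : 0 <= c by rewrite divr_ge0 ?ltW// subr_gt0.
have [e_ge0 e2_gt0] : 0 <= e /\ 0 < e *+ 2 by split; [exact: ltW | rewrite mulrn_wgt0].
have itv0 : `[- e, e]%classic = `[0 - e, 0 + e]%classic :> set R by rewrite sub0r add0r.
have near0 x : `|x| <= e *+ 2 ->
    c * resolvent_op r \1_`[- e, e] x <= resolvent_op r \1_`[b - e, b + e] x.
  move=> xe; rewrite itv0; apply: (@le_trans _ _ ((r b - delta) * (e *+ 2))).
    apply: (@le_trans _ _ (c * ((r 0 + delta) * (e *+ 2)))).
      rewrite ler_wpM2l// resolvent_op_itv_le// => u ue; rewrite sub0r.
      have [|_] := h1 (u - x); last by rewrite addr0.
      by rewrite (le_trans (ler_normB _ _))//; move: xe; rewrite !mulrS; lra.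
    by rewrite /c mulrA divfK// gt_eqF.
  apply: resolvent_op_itv_ge => // u ue.
  have [|+ _] := h2 (u - x); last by rewrite addrA (addrAC u).
  by rewrite (le_trans (ler_normB _ _))//; move: xe; rewrite !mulrS; lra.
have := domination X_levy q0 hr e0 c0 (bounded_itv _ _) (itv_ge0 _ _) near0 (- a).
rewrite itv0 => key.
have k1 : (r a - delta) * (e *+ 2) <= resolvent_op r \1_`[0 - e, 0 + e] (- a).
  apply: resolvent_op_itv_ge => // u ue; rewrite sub0r opprK.
  by have [|+ _] := h3 u; [rewrite !mulrS; lra | lra].
have k2 : resolvent_op r \1_`[b - e, b + e] (- a) <= (r (a + b) + delta) * (e *+ 2).
  apply: resolvent_op_itv_le => // u ue; rewrite opprK (addrC b).
  by have [|_] := h4 u; [rewrite !mulrS; lra | lra].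
have : c * (r a - delta) <= r (a + b) + delta.
  rewrite -(ler_pM2r e2_gt0) -mulrA; apply: le_trans (le_trans key k2).
  by rewrite ler_wpM2l.
by rewrite /c mulrAC ler_pdivrMr// /K; nra.
Qed.

(** Maximum principle: the constant [1 / q] is itself a potential, that of the
    constant function [1], so the potential of a small interval around [0] is
    largest, up to small errors, near the interval. *)
Lemma resolvent_le0 z : r z <= r 0.
Proof.
have r0 := resolvent_ge0 hr.
rewrite leNgt; apply/negP => rz.
pose delta := (r z - r 0) / 4; have delta0 : 0 < delta by rewrite /delta; lra.
have [e1 e10 h1] := oscillation 0 delta0.
have [e2 e20 h2] := oscillation z delta0.
pose e := Num.min e1 e2.
have e0 : 0 < e by rewrite !lt_min e10 e20.
have le1 : e <= e1 by rewrite !ge_min lexx.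
have le2 : e <= e2 by rewrite !ge_min lexx orbT.
have [e_ge0 e2_gt0] : 0 <= e /\ 0 < e *+ 2 by split; [exact: ltW | rewrite mulrn_wgt0].
have A0 : 0 < r 0 + delta by rewrite ltr_wpDl.
pose c := q^-1 / ((r 0 + delta) * (e *+ 2)).
have c0 : 0 < c by rewrite !divr_gt0 ?invr_gt0 ?mulr_gt0.
have itv0 : `[- e, e]%classic = `[0 - e, 0 + e]%classic :> set R by rewrite sub0r add0r.
have opcst x : resolvent_op r (fun=> 1) x = q^-1.
  by rewrite /resolvent_op (potential_cst q0 hr) div1r.
have near0 x : `|x| <= e *+ 2 ->
    c * resolvent_op r \1_`[- e, e] x <= resolvent_op r (fun=> 1) x.
  move=> xe; rewrite itv0 opcst.
  apply: (@le_trans _ _ (c * ((r 0 + delta) * (e *+ 2)))); last first.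
    by rewrite /c divfK// gt_eqF// mulr_gt0.
  rewrite ler_pM2l// resolvent_op_itv_le// => u ue; rewrite sub0r.
  have [|_] := h1 (u - x); last by rewrite addr0.
  by rewrite (le_trans (ler_normB _ _))//; move: xe; rewrite !mulrS; lra.
have := domination X_levy q0 hr e0 (ltW c0) (bounded_mfun_cst _) (fun=> ler01) near0 (- z).
rewrite itv0 opcst => key.
have k1 : (r z - delta) * (e *+ 2) <= resolvent_op r \1_`[0 - e, 0 + e] (- z).
  apply: resolvent_op_itv_ge => // u ue; rewrite sub0r opprK.
  by have [|+ _] := h2 u; [rewrite !mulrS; lra | lra].
have : c * ((r z - delta) * (e *+ 2)) <= q^-1.
  by apply: le_trans key; rewrite ler_pM2l.
have -> : q^-1 = c * ((r 0 + delta) * (e *+ 2)).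
  by rewrite /c divfK// gt_eqF// mulr_gt0.
by rewrite ler_pM2l// ler_pM2r// /delta; lra.
Qed.

Lemma resolvent0_gt0 : 0 < r 0.
Proof.
rewrite lt_neqAle eq_sym (resolvent_ge0 hr) andbT; apply/negP => /eqP h0.
have := resolvent_mass q0 hr.
have rx0 x : r x = 0.
  by apply/le_anti; rewrite (resolvent_ge0 hr) andbT -h0 resolvent_le0.
under eq_integral do rewrite rx0.
rewrite integral0 => -[] /esym /eqP.
by rewrite invr_eq0 gt_eqF.
Qed.

(** From the product inequality and
    [0 <= (r 0 - r a) * (r 0 - r b)], after division by [r 0]. *)
Lemma resolvent_gap_subadditive (a b : R) :
  r 0 - r (a + b) <= (r 0 - r a) + (r 0 - r b).
Proof.
have := resolvent_mul_le a b; have r00 := resolvent0_gt0.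
have := resolvent_le0 a; have := resolvent_le0 b => h1 h2 h3.
rewrite -(ler_pM2l r00).
have : 0 <= (r 0 - r a) * (r 0 - r b) by rewrite mulr_ge0// subr_ge0.
nra.
Qed.

End density_inequalities.

(** * Recurrence *)

Lemma cvg_Rintegral_dominated {d : measure_display} {T : measurableType d} {R : realType}
    (m : {measure set T -> \bar R}) (D : set T) (f_ : nat -> T -> R) (f g : T -> R) :
  measurable D -> (forall n, measurable_fun D (f_ n)) ->
  (forall x, D x -> f_ n x @[n --> \oo] --> f x) ->
  m.-integrable D (EFin \o g) -> (forall n x, D x -> `|f_ n x| <= g x) ->
  \int[m]_(x in D) f_ n x @[n --> \oo] --> \int[m]_(x in D) f x.
Proof.
move=> mD mf ff ig fg.
have mlim : measurable_fun D f by exact: measurable_fun_cvg mf ff.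
have [||||| fi _ cv] := @dominated_convergence _ _ _ m D mD (fun n x => (f_ n x)%:E)
  (EFin \o f) (EFin \o g).
- by move=> n; apply/measurable_EFinP.
- exact/measurable_EFinP.
- by apply: aeW => x Dx; apply: cvg_EFin; [exact: nearW | exact: ff].
- exact: ig.
- by apply: aeW => x n Dx; rewrite lee_fin fg.
rewrite /Rintegral; apply: fine_cvg.
by rewrite fineK//; exact: integrable_fin_num.
Qed.

Section recurrence.
Context {R : realType} {d : measure_display} {Omega : measurableType d}.
Variable P : probability Omega R.
Variable X : R -> {RV P >-> R}.
Hypothesis X_levy : levy_process X.
Hypothesis X_recurrent : recurrent X.
Local Notation mu := (@lebesgue_measure R).
Variable r_ : nat -> R -> R.
(** The limit as [q] tends to [0] is taken along this sequence, for which the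
    convergence theorems for sequences are available. *)
Let q_ n : R := n.+1%:R^-1.
Hypothesis r_density : forall n, resolvent_density X (q_ n) (r_ n).

Let q_gt0 n : 0 < q_ n. Proof. by rewrite invr_gt0 ltr0n. Qed.

Let q_cvg : q_ n @[n --> \oo] --> 0. Proof. exact: cvg_harmonic. Qed.

(** By monotone convergence the [q]-potential of the interval ]-1, 1[ increases
    to its total occupation time, which is infinite; this potential is at most
    [2 * r_ n 0]. *)
Lemma resolvent0_cvgy : r_ n 0 @[n --> \oo] --> +oo.
Proof.
pose B : set R := `]-1, 1[%classic.
have bB : bounded_mfun (\1_B : R -> R) by apply: bounded_mfun_indic; exact: measurable_itv.
have B0 (x : R) : 0 <= \1_B x :> R by rewrite indicE.
have [mB _] := bB.
pose m t := translate_mean X (Num.max 0 t) \1_B 0.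
have m0 t : 0 <= m t by exact: translate_mean_ge0.
have mm : measurable_fun setT m by exact: measurable_translate_mean_time.
have potE n : (potential (r_ n) \1_B)%:E =
    (\int[mu]_(t in `[0%R, +oo[) (expR (- (q_ n * t)) * m t)%:E)%E.
  rewrite (potential_time X_levy (q_gt0 n) (r_density n) bB B0); apply: eq_integral => t.
  by rewrite inE/= in_itv/= andbT => t0; rewrite /m (max_idPr t0).
have moo : (\int[mu]_(t in `[0%R, +oo[) (m t)%:E = +oo)%E.
  rewrite -(X_recurrent 0 ltr01).
  pose f (z : Omega * R) : \bar R := (\1_B (X (Num.max 0 z.2) z.1))%:E.
  transitivity (\int[P]_w \int[mu]_(t in `[0%R, +oo[) f (w, t))%E.
    rewrite tonelli_on//.
    - apply: eq_integral => t _; rewrite /m EFin_translate_mean//.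
      by apply: eq_integral => w _; rewrite add0r.
    - by apply/measurable_EFinP; apply: measurableT_comp => //; exact: measurable_path.
    - by move=> z; rewrite lee_fin.
  apply: eq_integral => w _; apply: eq_integral => t.
  rewrite inE/= in_itv/= andbT => t0; rewrite /f/= (max_idPr t0); congr (_%:E).
  rewrite !indicE; congr (nat_of_bool _)%:R; apply/idP/idP; rewrite !inE/= subr0 /B/= in_itv/= ltr_norml//.
have : (potential (r_ n) \1_B)%:E @[n --> \oo] --> +oo%E.
  pose k n t := (expR (- (q_ n * t)) * m t)%:E.
  have limk t : limn (k ^~ t) = (m t)%:E.
    apply/cvg_lim => //; apply: cvg_EFin; first exact: nearW.
    rewrite -[X in _ --> X]mul1r; apply: cvgMl.
    have -> : 1 = expR (- (0 * t)) by rewrite mul0r oppr0 expR0.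
    by apply: continuous_cvg; [exact: continuous_expR | apply: cvgN; exact: cvgMl].
  have -> : +oo%E = (\int[mu]_(t in `[0%R, +oo[) limn (k ^~ t))%E.
    by rewrite -moo; apply: eq_integral => t _; rewrite limk.
  under eq_cvg do rewrite potE.
  apply: cvg_monotone_convergence => //.
  - move=> n; apply/measurable_EFinP; apply: measurable_funTS; apply: measurable_funM => //.
    exact: measurable_expR_decay.
  - by move=> n t _; rewrite lee_fin mulr_ge0// expR_ge0.
  - move=> t; rewrite /= in_itv/= andbT => t0 a b ab; rewrite lee_fin ler_wpM2r// ler_expR lerN2 ler_wpM2r//.
    by rewrite lef_pV2 ?posrE ?ltr0n// ler_nat.
move=> /cvgeyPge h; apply/cvgryPge => A.
have := h (A * 2); apply: filterS => n; rewrite lee_fin => hn.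
suff : potential (r_ n) \1_B <= r_ n 0 * 2 by lra.
rewrite -lee_fin (EFin_potential (q_gt0 n) (r_density n))// integral_indicM.
apply: (@le_trans _ _ (\int[mu]_(x in B) (cst (r_ n 0)%:E x))%E).
  apply: ge0_le_integral => //.
  - exact: measurable_itv.
  - by move=> x _; rewrite lee_fin (resolvent_ge0 (r_density n)).
  - apply/measurable_EFinP; apply: measurable_funTS.
    by have [] := resolvent_bounded_mfun (r_density n).
  - by move=> x _; rewrite lee_fin (resolvent_le0 X_levy (q_gt0 n) (r_density n)).
rewrite integral_cst//=; last exact: measurable_itv.
by rewrite /B lebesgue_measure_itv/= lte_fin gtrN//= -EFinD -EFinM opprK.
Qed.

End recurrence.

(** * A recurrent process with integrable increments is centered *)

Section zero_mean.
Context {R : realType} {d : measure_display} {Omega : measurableType d}.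
Variable P : probability Omega R.
Variable X : R -> {RV P >-> R}.
Hypothesis X_levy : levy_process X.
Hypothesis X_recurrent : recurrent X.
Local Notation mu := (@lebesgue_measure R).
Variable r_ : nat -> R -> R.
Let q_ n : R := n.+1%:R^-1.
Hypothesis r_density : forall n, resolvent_density X (q_ n) (r_ n).
Variable h : R -> R.
Hypothesis h_limit : forall x, r_ n 0 - r_ n (- x) @[n --> \oo] --> h x.

Let q_gt0 n : 0 < q_ n. Proof. by rewrite invr_gt0 ltr0n. Qed.

(** The differences [r_ n 0 - r_ n u] converge while [r_ n 0] tends to infinity. *)
Lemma resolvent_ratio_cvg1 u : r_ n u / r_ n 0 @[n --> \oo] --> (1 : R).
Proof.
have r00 n : 0 < r_ n 0 := resolvent0_gt0 X_levy (q_gt0 n) (r_density n).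
have -> : (fun n => r_ n u / r_ n 0) = (fun n => 1 - (r_ n 0 - r_ n (- - u)) * (r_ n 0)^-1).
  by apply/funext => n; rewrite opprK mulrBl divff ?gt_eqF// opprB addrCA subrr addr0.
rewrite -[X in _ --> X]subr0 -[X in _ - X](mulr0 (h (- u))).
apply: cvgB; first exact: cvg_cst.
apply: cvgM; first exact: h_limit.
apply/gtr0_cvgV0; first exact: nearW.
exact: (resolvent0_cvgy X_levy X_recurrent r_density).
Qed.

Hypothesis X1_integrable : P.-integrable setT (EFin \o X 1).

(** The half-line is the right test set because the integral over the starting
    point [x] of the change of its indicator along a step [y] is exactly [y]
    (see [kernel_int]). *)
Let F : R -> R := \1_`]0, +oo[.

Let bF : bounded_mfun F.
Proof. by apply: bounded_mfun_indic; exact: measurable_itv. Qed.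

Let F0 x : 0 <= F x. Proof. by rewrite /F indicE. Qed.

Let F1 x : F x <= 1. Proof. by rewrite /F indicE; case: (_ \in _). Qed.

Let phi x := translate_mean X 1 F x - F x.

Let bphi : bounded_mfun phi.
Proof. by apply: bounded_mfunB => //; exact: bounded_mfun_translate_mean. Qed.

(** In the potential of [P_1 F - F] the resolvent identity cancels everything
    but the occupation before time [1] and a term of order [(e^q - 1) / q]; so
    it stays bounded although [r_ n 0] blows up. *)
Let potential_phi n : `|potential (r_ n) phi| <= 2 * expR 1.
Proof.
have q0 := q_gt0 n; have hr := r_density n.
have q1 : q_ n <= 1 by rewrite invf_le1// ler1n.
have bP := bounded_mfun_translate_mean X 1 bF F0.
have -> : potential (r_ n) phi = potential (r_ n) (translate_mean X 1 F) - potential (r_ n) F.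
  rewrite /phi (potentialD q0 hr)//; last exact: bounded_mfunN.
  rewrite -[X in _ = _ + X]mulN1r -(potentialZ q0 hr)//.
  by congr (_ + potential _ _); apply/funext => x; rewrite mulN1r.
have := resolvent_identity_ge0 X_levy q0 hr ler01 bF F0; rewrite mulr1.
set A := initial_occupation _ _ _ _; set U := potential _ F; set V := potential _ (translate_mean _ _ _).
move=> UE.
have A0 : 0 <= A by apply: initial_occupation_ge0.
have A1 : A <= 1.
  rewrite -[leRHS](mulr1 1); apply: (initial_occupation_le X_levy q0) => //.
  by move=> t _; apply: translate_mean_le.
have U0 : 0 <= U.
  by apply: Rintegral_ge0 => x _; rewrite mulr_ge0// (resolvent_ge0 hr).
have U1 : U * q_ n <= 1.
  rewrite -ler_pdivlMr// -(potential_cst q0 hr).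
  by apply: (le_potential q0 hr) => //; exact: bounded_mfun_cst.
have VE : V = expR (q_ n) * (U - A).
  by rewrite UE addrC addKr mulrA -expRD subrr expR0 mul1r.
have e1 : expR (q_ n) <= expR 1 by rewrite ler_expR.
have e2 : expR (q_ n) - 1 <= q_ n * expR 1.
  apply: (@le_trans _ _ (q_ n * expR (q_ n))); last by rewrite ler_wpM2l// ltW.
  have := ler_wpM2r (expR_ge0 (q_ n)) (expR_ge1Dx (- q_ n)).
  by rewrite -expRD addNr expR0; lra.
have e3 := expR_ge1Dx (q_ n).
have e4 : (expR (q_ n) - 1) * U <= expR 1.
  apply: (@le_trans _ _ (q_ n * expR 1 * U)); first by rewrite ler_wpM2r.
  by rewrite mulrAC (mulrC (q_ n)) ler_piMl ?expR_ge0.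
have e5 : 0 <= (expR (q_ n) - 1) * U by apply: mulr_ge0 => //; lra.
have e6 : expR (q_ n) * A <= expR 1.
  by rewrite -[leRHS]mulr1 ler_pM ?expR_ge0.
have e7 : 0 <= expR (q_ n) * A by rewrite mulr_ge0 ?expR_ge0.
have -> : V - U = (expR (q_ n) - 1) * U - expR (q_ n) * A by rewrite VE; ring.
by rewrite ler_norml; apply/andP; split; lra.
Qed.

Let kernel (z : R * Omega) : R := F (z.1 + X 1 z.2) - F z.1.

Let measurable_kernel : measurable_fun setT kernel.
Proof.
have [mF _] := bF.
apply: measurable_funB; last exact: measurableT_comp.
apply: measurableT_comp => //; apply: measurable_funD => //.
by apply: measurableT_comp => //; exact: measurable_funPT.
Qed.

Let kernelE (y x : R) : F (x + y) - F x = \1_`]- y, 0] x - \1_`]0, - y] x.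
Proof.
rewrite /F !indicE /=.
rewrite (_ : (_ \in `]0, +oo[%classic) = (0 < x + y)); last first.
  by apply/idP/idP; rewrite inE/= in_itv/= andbT.
rewrite (_ : (_ \in `]0, +oo[%classic) = (0 < x)); last first.
  by apply/idP/idP; rewrite inE/= in_itv/= andbT.
rewrite (_ : (_ \in _) = (- y < x <= 0)); last first.
  by apply/idP/idP; rewrite inE/= in_itv/=.
rewrite (_ : (_ \in _) = (0 < x <= - y)); last first.
  by apply/idP/idP; rewrite inE/= in_itv/=.
rewrite -ltrBlDr sub0r; case: (leP x 0) => x0; rewrite ?andbT ?andbF/= ?subr0//.
by case: ltP => // _ /=; rewrite ?subrr ?sub0r.
Qed.

Let itv_int (a b : R) : a <= b -> (\int[mu]_x (\1_`]a, b] x)%:E = (b - a)%:E)%E.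
Proof.
move=> ab; rewrite integral_indic//= setIT lebesgue_measure_itv/= lte_fin.
by case: ltgtP ab => // -> _; rewrite subrr.
Qed.

Let itv_empty (a b x : R) : b <= a -> \1_`]a, b] x = 0 :> R.
Proof.
move=> ba; rewrite indicE memNset//= in_itv/= => /andP[h1 h2].
by have := lt_le_trans h1 (le_trans h2 ba); rewrite ltxx.
Qed.

Let kernel_norm (y : R) : (\int[mu]_x `|(F (x + y) - F x)%:E| = `|y%:E|)%E.
Proof.
have [Y0|Y0] := leP 0 y.
- rewrite (gee0_abs (_ : 0 <= y%:E)%E) ?lee_fin// -[y in RHS](opprK) -[in RHS]sub0r -itv_int ?oppr_le0//.
  apply: eq_integral => x _; rewrite kernelE (itv_empty x (_ : - y <= 0)) ?oppr_le0//.
  by rewrite subr0 gee0_abs// lee_fin indicE.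
- rewrite (lte0_abs (_ : y%:E < 0)%E) ?lte_fin// -EFinN -[- y in RHS]subr0 -itv_int ?oppr_ge0 ?ltW//.
  apply: eq_integral => x _; rewrite kernelE (itv_empty x (_ : 0 <= - y)) ?oppr_ge0 ?ltW//.
  by rewrite sub0r EFinN abseN gee0_abs// lee_fin indicE.
Qed.

Let kernel_int (y : R) : (\int[mu]_x (F (x + y) - F x)%:E = y%:E)%E.
Proof.
have [Y0|Y0] := leP 0 y.
- rewrite -[y in RHS](opprK) -[in RHS]sub0r -itv_int ?oppr_le0//.
  apply: eq_integral => x _; rewrite kernelE (itv_empty x (_ : - y <= 0)) ?oppr_le0//.
  by rewrite subr0.
- rewrite -[y in RHS]opprK EFinN -[- y in RHS]subr0 -itv_int ?oppr_ge0 ?ltW//.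
  rewrite -integral_ge0N//.
  apply: eq_integral => x _; rewrite kernelE (itv_empty x (_ : 0 <= - y)) ?oppr_ge0 ?ltW//.
  by rewrite sub0r EFinN.
Qed.

(** The potential of [P_1 F - F], divided by [r_ n 0], is the integral of
    [P_1 F - F] against a ratio which tends to [1]. Hence it tends to the
    integral of [P_1 F - F], which is the mean of [X 1] by Fubini's theorem;
    but it also tends to [0]. *)
Lemma zero_mean : \int[P]_w X 1 w = 0.
Proof.
have ik : (mu \x P)%E.-integrable setT (EFin \o kernel).
  apply/integrable21ltyP; first exact/measurable_EFinP.
  have /integrableP[_] := X1_integrable; congr (_ < _)%E.
  by apply: eq_integral => w _; rewrite -[LHS]/(`|(X 1 w)%:E|)%E -kernel_norm.
have phiE : fubini_F P (EFin \o kernel) = EFin \o phi.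
  apply/funext => x; rewrite /fubini_F /= /phi EFinB EFin_translate_mean//.
  under eq_integral do rewrite EFinB.
  rewrite integralB_EFin//=.
  - by rewrite integral_cst//= probability_setT mule1.
  - by apply: bounded_mfun_integrable => //; exact: bounded_mfun_path.
  - by apply: bounded_mfun_integrable => //; exact: (bounded_mfun_cst (F x)).
have iphi : mu.-integrable setT (EFin \o phi).
  by rewrite -phiE; exact: integrable_fubini_F.
have intE : \int[mu]_x phi x = \int[P]_w X 1 w.
  rewrite /Rintegral; congr fine.
  rewrite -[LHS]/(\int[mu]_x (EFin \o phi) x)%E -phiE.
  rewrite (Fubini ik); apply: eq_integral => w _; exact: (kernel_int (X 1 w)).
rewrite -intE.
have r00 n : 0 < r_ n 0 := resolvent0_gt0 X_levy (q_gt0 n) (r_density n).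
have c1 : potential (r_ n) phi / r_ n 0 @[n --> \oo] --> \int[mu]_x phi x.
  have -> : (fun n => potential (r_ n) phi / r_ n 0) =
            (fun n => \int[mu]_x (phi x * (r_ n x / r_ n 0))).
    apply/funext => n; rewrite /potential -RintegralZr//; last first.
      exact: (potential_integrable (q_gt0 n) (r_density n)).
    by apply: eq_Rintegral => x _; rewrite mulrA.
  have [mphi _] := bphi.
  apply: (@cvg_Rintegral_dominated _ _ _ mu setT (fun n x => phi x * (r_ n x / r_ n 0)) phi (fun x => `|phi x|)) => //.
  - move=> n; apply: measurable_funM => //; apply: measurable_funM => //.
    by have [] := resolvent_bounded_mfun (r_density n).
  - move=> x _; rewrite -[X in _ --> X]mulr1; apply: cvgMr; exact: resolvent_ratio_cvg1.
  - exact: integrable_norm iphi.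
  - move=> n x _; rewrite normrM ler_piMr// ger0_norm ?divr_ge0 ?(resolvent_ge0 (r_density n))//.
    by rewrite ler_pdivrMr// mul1r (resolvent_le0 X_levy (q_gt0 n) (r_density n)).
have c2 : potential (r_ n) phi / r_ n 0 @[n --> \oo] --> 0.
  apply: norm_cvg0.
  apply: (@squeeze_cvgr _ _ _ _ (cst 0) (fun n => 2 * expR 1 / r_ n 0)).
  - apply: nearW => n; rewrite normr_ge0 normrM ler_pM//.
    by rewrite ger0_norm// invr_ge0 ltW.
  - exact: cvg_cst.
  - rewrite -[X in _ --> X](mulr0 (2 * expR 1)); apply: cvgMr.
    apply/gtr0_cvgV0; first exact: nearW.
    exact: (resolvent0_cvgy X_levy X_recurrent r_density).
exact: (cvg_unique _ c1 c2).
Qed.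

End zero_mean.

(** * A central limit theorem for the resolvent *)

Section weak_limit.
Context {R : realType} {d : measure_display} {Omega : measurableType d}.
Variable P : probability Omega R.
Variable X : R -> {RV P >-> R}.
Hypothesis X_levy : levy_process X.
Local Notation mu := (@lebesgue_measure R).
Variable r_ : nat -> R -> R.
Let q_ n : R := n.+1%:R^-1.
Hypothesis r_density : forall n, resolvent_density X (q_ n) (r_ n).
Hypothesis X1_integrable : P.-integrable setT (EFin \o X 1).
Hypothesis X1_centered : \int[P]_w X 1 w = 0.
Hypothesis X1_sqr_integrable : P.-integrable setT (EFin \o (fun w => X 1 w ^+ 2)).
Let s2 := \int[P]_w (X 1 w ^+ 2).

Variable b : nat -> R.
(** The sign of [b n] is left free, so that either half-line can be scaled onto
    the support of a one-sided test function. *)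
Hypothesis b_sqr : forall n, b n ^+ 2 = q_ n.

Variables (f f1 f2 : R -> R) (K : R).
Hypotheses (bf : bounded_mfun f) (f0 : forall x, 0 <= f x) (bf2 : bounded_mfun f2).
Hypothesis f_cont : f x @[x --> 0] --> f 0.
Hypothesis f_taylor : forall x z,
  `|f (x + z) - (f x + z * f1 x + z ^+ 2 / 2 * f2 x)| <= z ^+ 2 * (K * Num.min 1 `|z|).

Let q_gt0 n : 0 < q_ n. Proof. by rewrite invr_gt0 ltr0n. Qed.

Let q_le1 n : q_ n <= 1. Proof. by rewrite invf_le1// ler1n. Qed.

Let q_cvg : q_ n @[n --> \oo] --> 0. Proof. exact: cvg_harmonic. Qed.

Let b_cvg : b n @[n --> \oo] --> 0.
Proof.
apply: norm_cvg0; have -> : (fun n => `|b n|) = fun n => Num.sqrt (q_ n).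
  by apply/funext => n; rewrite -b_sqr sqrtr_sqr.
by rewrite -[X in _ --> X]sqrtr0; apply: continuous_cvg => //; exact: sqrt_continuous.
Qed.

Let F n x := f (b n * x).

Let F_ge0 n x : 0 <= F n x. Proof. exact: f0. Qed.

Let bscale n (g : R -> R) : bounded_mfun g -> bounded_mfun (fun x : R => g (b n * x)).
Proof.
move=> [mg [M gM]]; split; last by exists M.
by apply: measurableT_comp => //; exact: measurable_funM.
Qed.

Let mX t : measurable_fun setT (X t : Omega -> R).
Proof. exact: measurable_funPT. Qed.

(** In the limit the scaled process is still at [0] at time [1]. *)
Let initial_cvg : initial_occupation X (q_ n) 1 (F n) @[n --> \oo] --> f 0.
Proof.
have [mf [M fM]] := bf.
have -> : f 0 = \int[mu]_(t in `[0, 1[) f 0.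
  by rewrite Rintegral_cst//= lebesgue_measure_itv/= lte_fin ltr01/= subr0 mulr1.
have mF n : measurable_fun (`[0%R, 1%R[%classic : set R) (fun t => expR (- (q_ n * t)) * translate_mean X t (F n) 0).
  have /integrableP[/measurable_EFinP//] :=
    initial_occupation_integrable X_levy (q_gt0 n) 1 (bscale n bf) (fun x => f0 (b n * x)).
apply: (@cvg_Rintegral_dominated _ _ _ mu `[0, 1[%classic
  (fun n t => expR (- (q_ n * t)) * translate_mean X t (F n) 0) (cst (f 0)) (cst M)) => //.
- move=> t _; rewrite /cst -[X in _ --> X]mul1r; apply: cvgM.
    have -> : 1 = expR (- (0 * t)) by rewrite mul0r oppr0 expR0.
    by apply: continuous_cvg; [exact: continuous_expR | apply: cvgN; exact: cvgMl].
  have -> : f 0 = \int[P]_w f 0 by rewrite Rintegral_cst//= probability_setT mulr1.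
  apply: (@cvg_Rintegral_dominated _ _ _ P setT
    (fun n w => f (b n * (0 + X t w))) (cst (f 0)) (cst M)) => //.
  + move=> n; apply: measurableT_comp => //; apply: measurable_funM => //.
    exact: measurable_funD.
  + move=> w _; have cz : b n * (0 + X t w) @[n --> \oo] --> (0 : R).
      by rewrite -[X in _ --> X](mul0r (0 + X t w)); exact: cvgMl.
    exact: (cvg_comp _ _ cz f_cont).
  + exact: finite_measure_integrable_cst.
- apply: measurable_bounded_integrable => //.
    by rewrite /= lebesgue_measure_itv/=; case: ifP => // _; rewrite ltry.
  by exists `|M|; split; [rewrite num_real | move=> z zM y _; exact: ltW].
- move=> n t; rewrite /= in_itv/= => /andP[t0 _].
  have T0 : 0 <= translate_mean X t (F n) 0 by apply: translate_mean_ge0; exact: F_ge0.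
  rewrite ger0_norm ?mulr_ge0 ?expR_ge0//.
  rewrite -[leRHS]mul1r ler_pM ?expR_ge0//.
    by rewrite -expR0 ler_expR oppr_le0 mulr_ge0// ltW.
  apply: translate_mean_le; first exact: (bscale n bf).
  by move=> x; exact: le_trans (ler_norm _) (fM _).
Qed.

(** The Taylor remainder per unit of [q_ n]; the truncation by [1] makes it
    dominated by the square of the step, which is all that is integrable. *)
Let eta n : R := \int[P]_w (X 1 w ^+ 2 * (K * Num.min 1 `|b n * X 1 w|)).

Let K0 : 0 <= K.
Proof.
have := le_trans (normr_ge0 _) (f_taylor 0 1).
by rewrite expr1n mul1r normr1 minxx mulr1.
Qed.

Let min_bound n w : 0 <= K * Num.min 1 `|b n * X 1 w| <= K.
Proof.
rewrite mulr_ge0 ?le_min ?ler01 ?normr_ge0//=.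
by rewrite ler_piMr// ge_min lexx.
Qed.

Let measurable_eta n : measurable_fun setT (fun w => X 1 w ^+ 2 * (K * Num.min 1 `|b n * X 1 w|)).
Proof.
apply: measurable_funM; first exact: measurable_funX.
apply: measurable_funM => //; apply: measurable_minr => //.
by apply: measurableT_comp => //; exact: measurable_funM.
Qed.

Let dominating : P.-integrable setT (EFin \o (fun w => X 1 w ^+ 2 * K)).
Proof.
have := integrableZr measurableT K X1_sqr_integrable.
by apply: eq_integrable.
Qed.

Let eta_integrable n :
  P.-integrable setT (EFin \o (fun w => X 1 w ^+ 2 * (K * Num.min 1 `|b n * X 1 w|))).
Proof.
apply: (@le_integrable _ _ _ _ _ _ _ (fun w => (X 1 w ^+ 2 * K)%:E)) => //.
  exact/measurable_EFinP.
move=> w _; rewrite lee_fin !(normrM (X 1 w ^+ 2)) ler_wpM2l//.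
by have /andP[h1 h2] := min_bound n w; rewrite (ger0_norm K0) ger0_norm.
Qed.

Let eta_cvg : eta n @[n --> \oo] --> 0.
Proof.
have -> : 0 = \int[P]_w (cst (0 : R)) w.
  by rewrite /cst Rintegral_cst//= mul0r.
apply: (@cvg_Rintegral_dominated _ _ _ P setT
    (fun n w => X 1 w ^+ 2 * (K * Num.min 1 `|b n * X 1 w|)) (cst 0)
    (fun w => X 1 w ^+ 2 * K)) => //.
- move=> w _; rewrite /cst.
  apply: (@squeeze_cvgr _ _ _ _ (cst 0) (fun n => X 1 w ^+ 2 * K * `|b n * X 1 w|)).
  + apply: nearW => n; have /andP[h1 _] := min_bound n w.
    rewrite mulr_ge0 ?sqr_ge0//= -mulrA ler_wpM2l ?sqr_ge0// ler_wpM2l//.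
    by rewrite ge_min lexx orbT.
  + exact: cvg_cst.
  + rewrite -[X in _ --> X](mulr0 (X 1 w ^+ 2 * K)); apply: cvgMr.
    have -> : 0 = `|0 * X 1 w| by rewrite mul0r normr0.
    by apply: cvg_norm; exact: cvgMl.
- move=> n w _; have /andP[h1 h2] := min_bound n w.
  by rewrite (ger0_norm (mulr_ge0 (sqr_ge0 _) h1)) ler_wpM2l ?sqr_ge0.
Qed.

(** The first order term vanishes because the step is centered. *)
Let mean_taylor n x :
  `|translate_mean X 1 (F n) x - (F n x + q_ n * s2 / 2 * f2 (b n * x))| <= q_ n * eta n.
Proof.
have iF : P.-integrable setT (EFin \o (fun w => F n (x + X 1 w))).
  apply: bounded_mfun_integrable => //; exact: bounded_mfun_path x 1 (bscale n bf).
have icst (c : R) : P.-integrable setT (EFin \o (fun w : Omega => c)).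
  exact: finite_measure_integrable_cst.
have iZ (c : R) : P.-integrable setT (EFin \o (fun w => c * X 1 w)).
  have := integrableZl measurableT c X1_integrable; exact: eq_integrable.
have iZ2 (c : R) : P.-integrable setT (EFin \o (fun w => c * X 1 w ^+ 2)).
  have := integrableZl measurableT c X1_sqr_integrable; exact: eq_integrable.
pose T w := F n x + (b n * f1 (b n * x)) * X 1 w + (q_ n / 2 * f2 (b n * x)) * X 1 w ^+ 2.
have iT : P.-integrable setT (EFin \o T).
  have iT1 : P.-integrable setT (EFin \o (fun w => F n x + (b n * f1 (b n * x)) * X 1 w)).
    exact: (integrableD measurableT (icst _) (iZ _)).
  exact: (integrableD measurableT iT1 (iZ2 _)).
have TE : \int[P]_w T w = F n x + q_ n * s2 / 2 * f2 (b n * x).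
  rewrite RintegralD//; last first.
    exact: (integrableD measurableT (icst _) (iZ _)).
  rewrite RintegralD// !RintegralZl// X1_centered mulr0 addr0.
  rewrite Rintegral_cst//= probability_setT mulr1 -/s2; congr (_ + _); ring.
rewrite -TE /translate_mean -RintegralB//.
apply: (le_trans (le_normr_Rintegral measurableT _)).
  exact: (integrableB measurableT iF iT).
rewrite /eta -RintegralZl//; apply: le_Rintegral => //.
- have := integrable_norm (integrableB measurableT iF iT); exact: eq_integrable.
- have := integrableZl measurableT (q_ n) (eta_integrable n); exact: eq_integrable.
- move=> w _; have := f_taylor (b n * x) (b n * X 1 w).
  rewrite /F /T -mulrDr exprMn b_sqr => h.
  rewrite mulrA; apply: le_trans h; rewrite le_eqVlt; apply/orP; left; apply/eqP.
  congr (`|_|); rewrite /F; ring.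
Qed.

(** Over one unit of time the mean of [f (b n * x)] changes by
    [q_ n * s2 / 2 * f2 (b n * x)], up to [o(q_ n)]. The resolvent
    has total mass [1 / q_ n], so in the resolvent identity the errors vanish,
    and what remains is the integral of [q_ n * (f - s2 / 2 * f2)] on one side
    and the occupation before time [1] on the other. *)
Lemma weak_limit :
  q_ n * potential (r_ n) (fun x => f (b n * x) - s2 / 2 * f2 (b n * x)) @[n --> \oo] --> f 0.
Proof.
have [_ [M fM]] := bf; have [_ [M2 f2M]] := bf2.
have M0 : 0 <= M := le_trans (normr_ge0 _) (fM 0).
have M20 : 0 <= M2 := le_trans (normr_ge0 _) (f2M 0).
have s20 : 0 <= s2 by apply: Rintegral_ge0 => w _; rewrite sqr_ge0.
pose bound n := q_ n * M + q_ n * (s2 / 2 * M2) + eta n.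
have main n : `|q_ n * potential (r_ n) (fun x => f (b n * x) - s2 / 2 * f2 (b n * x)) -
    initial_occupation X (q_ n) 1 (F n)| <= bound n.
  have q0 := q_gt0 n; have hr := r_density n.
  have bF : bounded_mfun (F n) := bscale n bf.
  have bF2 := bscale n bf2.
  have F0 x : 0 <= F n x by exact: f0.
  have bP := bounded_mfun_translate_mean X 1 bF F0.
  pose err x := translate_mean X 1 (F n) x - (F n x + q_ n * s2 / 2 * f2 (b n * x)).
  have berr : bounded_mfun err.
    by apply: bounded_mfunB => //; apply: bounded_mfunD => //; exact: bounded_mfunZ.
  have := resolvent_identity_ge0 X_levy q0 hr ler01 bF F0; rewrite mulr1.
  set A := initial_occupation _ _ _ _.
  have -> : potential (r_ n) (translate_mean X 1 (F n)) =
      potential (r_ n) (F n) + q_ n * s2 / 2 * potential (r_ n) (fun x => f2 (b n * x)) +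
      potential (r_ n) err.
    rewrite -(potentialZ q0 hr)// -(potentialD q0 hr)//; last exact: bounded_mfunZ.
    rewrite -(potentialD q0 hr)//; last by apply: bounded_mfunD => //; exact: bounded_mfunZ.
    by congr potential; apply/funext => x; rewrite /err addrC subrK.
  have -> : potential (r_ n) (fun x => f (b n * x) - s2 / 2 * f2 (b n * x)) =
      potential (r_ n) (F n) - s2 / 2 * potential (r_ n) (fun x => f2 (b n * x)).
    rewrite -[X in _ = _ + X]mulN1r -!(potentialZ q0 hr)//; last exact: bounded_mfunZ.
    rewrite -(potentialD q0 hr)//; last by do 2! apply: bounded_mfunZ.
    by congr potential; apply/funext => x; rewrite mulN1r.
  have h1 := potential_le_cst q0 hr bF (fun x => fM (b n * x)).
  have h2 := potential_le_cst q0 hr bF2 (fun x => f2M (b n * x)).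
  have h3 := potential_le_cst q0 hr berr (mean_taylor n).
  set U := potential _ (F n) in h1 *; set V := potential _ (fun x => f2 _) in h2 *.
  set W := potential _ err in h3 *; move=> AE.
  have {AE} AE : A = U - expR (- q_ n) * (U + q_ n * s2 / 2 * V + W) by apply/eqP; rewrite eq_sym subr_eq; apply/eqP.
  have -> : q_ n * (U - s2 / 2 * V) - A = (q_ n - 1 + expR (- q_ n)) * U -
      (1 - expR (- q_ n)) * (s2 / 2 * (q_ n * V)) + expR (- q_ n) * W.
    by rewrite AE; ring.
  have e0 := expR_ge0 (- q_ n).
  have e1 := expR_ge1Dx (- q_ n).
  have e2 : expR (- q_ n) <= 1 by rewrite -expR0 ler_expR oppr_le0 ltW.
  have e3 : q_ n - 1 + expR (- q_ n) <= q_ n ^+ 2.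
    have := ler_wpM2r e0 (expR_ge1Dx (q_ n)); rewrite -expRD subrr expR0 mulrDl mul1r => e4.
    have := q_le1 n; nra.
  have eE : q_ n * eta n / q_ n = eta n by rewrite mulrAC divff ?mul1r// gt_eqF.
  rewrite eE in h3.
  have qU : `|U| * q_ n <= M by rewrite -ler_pdivlMr.
  have qV : q_ n * `|V| <= M2 by rewrite mulrC -ler_pdivlMr.
  apply: (le_trans (ler_normD _ _)); apply: lerD.
    apply: (le_trans (ler_normB _ _)); apply: lerD.
      rewrite normrM ger0_norm; last by lra.
      apply: (@le_trans _ _ (q_ n ^+ 2 * `|U|)); first by rewrite ler_wpM2r.
      by rewrite expr2 -mulrA ler_wpM2l 1?mulrC// ltW.
    rewrite normrM ger0_norm ?subr_ge0// ler_pM ?subr_ge0//; first by lra.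
    rewrite normrM (ger0_norm (_ : 0 <= s2 / 2)) ?divr_ge0//.
    by rewrite ler_wpM2l ?divr_ge0// normrM gtr0_norm.
  rewrite normrM ger0_norm// -[leRHS]mul1r ler_pM//.
have bound_cvg : bound n @[n --> \oo] --> 0.
  rewrite -[X in _ --> X]addr0; apply: cvgD; last exact: eta_cvg.
  rewrite -[X in _ --> X]addr0; apply: cvgD.
    by rewrite -[X in _ --> X](mul0r M); exact: cvgMl.
  by rewrite -[X in _ --> X](mul0r (s2 / 2 * M2)); exact: cvgMl.
have diff_cvg : (q_ n * potential (r_ n) (fun x => f (b n * x) - s2 / 2 * f2 (b n * x)) -
    initial_occupation X (q_ n) 1 (F n)) @[n --> \oo] --> 0.
  apply: norm_cvg0; apply: (@squeeze_cvgr _ _ _ _ (cst 0) bound) => //.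
    by apply: nearW => n; rewrite normr_ge0 main.
  exact: cvg_cst.
rewrite -[X in _ --> X]add0r.
under eq_cvg => n do
  rewrite -[q_ n * _](subrK (initial_occupation X (q_ n) 1 (F n))).
exact: cvgD diff_cvg initial_cvg.
Qed.

End weak_limit.

(** * Second order Taylor estimates and gluing of derivatives *)

Section calculus.
Context {R : realType}.
Implicit Types (f g n p : R -> R).

Lemma mean_value_le f f' (B s x y : R) : (forall u : R, is_derive u 1 f (f' u)) ->
  (forall c, `|c - x| <= `|y - x| -> `|f' c - s| <= B) ->
  `|f y - f x - s * (y - x)| <= B * `|y - x|.
Proof.
move=> df bd.
have cf a b : {within `[a, b], continuous f}.
  by apply: derivable_within_continuous => u _; have [] := df u.
have mv a b : a <= b -> exists2 c, a <= c <= b & f b - f a = f' c * (b - a).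
  by move=> ab; have [c] := MVT_segment ab (fun u _ => df u) (cf a b); rewrite in_itv/=; exists c.
have [xy|yx] := leP x y.
- have [c /andP[xc cy] ->] := mv _ _ xy.
  rewrite -mulrBl normrM; apply: ler_wpM2r => //; apply: bd.
  by rewrite !ger0_norm ?subr_ge0// lerD2r.
- have [c /andP[yc cx] e] := mv _ _ (ltW yx).
  have -> : f y - f x - s * (y - x) = (f' c - s) * (y - x).
    by rewrite -[f y - f x]opprB e; ring.
  rewrite normrM; apply: ler_wpM2r => //; apply: bd.
  by rewrite !ler0_norm ?subr_le0 ?(ltW yx)// lerN2 lerD2r.
Qed.

(** Two applications of the mean value inequality, the modulus [w] of [f2]
    being carried along; a factor 1/2 is lost in the remainder. *)
Lemma second_order_taylor f f1 f2 (w : R -> R) :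
  (forall u : R, is_derive u 1 f (f1 u)) -> (forall u : R, is_derive u 1 f1 (f2 u)) ->
  (forall s t, s <= t -> w s <= w t) -> (forall u v, `|f2 u - f2 v| <= w `|u - v|) ->
  forall x z, `|f (x + z) - (f x + z * f1 x + z ^+ 2 / 2 * f2 x)| <= z ^+ 2 * w `|z|.
Proof.
move=> df df1 ndw osc x z.
have w0 : 0 <= w `|z|.
  by apply: (le_trans (normr_ge0 (f2 z - f2 0))); rewrite (le_trans (osc _ _))// subr0.
pose G : R -> R := f - (f1 x *: id + (f2 x / 2) *: (id - cst x) ^+ 2).
have GE t : G t = f t - (f1 x * t + f2 x / 2 * (t - x) ^+ 2) by [].
pose G' t := f1 t - (f1 x + (t - x) * f2 x).
have dG (u : R) : is_derive u 1 G (G' u).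
  have dfu := df u; apply: is_derive_eq.
  by rewrite /G' /GRing.scale /= -[(id - cst x) u]/(u - x); field.
have xz : x + z - x = z by rewrite addrAC subrr add0r.
have : `|G (x + z) - G x - 0 * (x + z - x)| <= (`|z| * w `|z|) * `|x + z - x|.
  apply: (mean_value_le dG) => c; rewrite xz => cz; rewrite subr0.
  have -> : G' c = f1 c - f1 x - f2 x * (c - x) by rewrite /G'; ring.
  apply: (@le_trans _ _ (w `|z| * `|c - x|)); last by rewrite mulrC ler_wpM2r.
  apply: (mean_value_le df1) => u uc.
  by rewrite (le_trans (osc _ _))// ndw// (le_trans uc).
rewrite mul0r subr0 xz !GE xz subrr expr0n/= mulr0 addr0.
have -> : `|z| * w `|z| * `|z| = z ^+ 2 * w `|z| by rewrite mulrAC -expr2 real_normK ?num_real.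
apply: le_trans; rewrite le_eqVlt; apply/orP; left; apply/eqP.
by congr (`|_|); field.
Qed.

(** At [0] the two growth rates have the same limit, and for each increment the
    growth rate of the glued function is one of them. *)
Lemma is_derive_glue n p n' p' : (forall u : R, is_derive u 1 n (n' u)) ->
  (forall u : R, is_derive u 1 p (p' u)) -> n 0 = p 0 -> n' 0 = p' 0 ->
  forall u : R, is_derive u 1 (fun x => if x <= 0 then n x else p x)
    (if u <= 0 then n' u else p' u).
Proof.
move=> dn dp np0 np1 u; set f := fun x => _.
have [u0|u0|->] := ltgtP u 0.
- apply: near_eq_is_derive (dn u); near=> x; rewrite /f ifT//.
  by apply: ltW; near: x; exact: lt_nbhsl.
- apply: near_eq_is_derive (dp u); near=> x; rewrite /f ifF//.
  by apply/negbTE; rewrite -ltNge; near: x; exact: lt_nbhsr.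
- have growth (g : R -> R) (l : R) : is_derive (0 : R) 1 g l ->
      (fun h : R => h^-1 *: ((g \o shift 0) (h *: 1) - g 0)) @ 0^' --> l.
    by move=> [dg <-]; exact: dg.
  have fcvg : (fun h : R => h^-1 *: ((f \o shift 0) (h *: 1) - f 0)) @ 0^' --> n' 0.
    have := growth _ _ (dn 0); have := growth _ _ (dp 0); rewrite -np1.
    move=> /cvgrPdist_lt cp /cvgrPdist_lt cn; apply/cvgrPdist_lt => e e0.
    have := cp e e0; have := cn e e0; apply: filterS2 => h.
    rewrite /f /= lexx -np0; by case: ifP.
  by apply: DeriveDef; [apply/cvg_ex; exists (n' 0) | exact: cvg_lim fcvg].
Unshelve. all: by end_near. Qed.

End calculus.

(** * Test functions on a half-line *)

Section test_function.
Context {R : realType}.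

(** This class of functions is stable under derivation, and contains both pieces
    of the test function below together with all their derivatives. *)
Definition exp_affine (k c0 c1 x : R) : R := (c0 + c1 * x) * expR (k * x).

Lemma is_derive_exp_affine k c0 c1 (u : R) : is_derive u 1 (exp_affine k c0 c1)
  (exp_affine k (c1 + k * c0) (k * c1) u).
Proof.
have -> : exp_affine k c0 c1 = (cst c0 + c1 *: id) * (expR \o (k *: id)) by [].
apply: is_derive_eq; rewrite /exp_affine /GRing.scale /=.
rewrite -[(cst c0 + c1 *: id) u]/(c0 + c1 * u); ring.
Qed.

Lemma exp_affine_bound k c0 c1 x : 0 < k -> x <= 0 ->
  `|exp_affine k c0 c1 x| <= `|c0| + `|c1| / k.
Proof.
move=> k0 x0; rewrite /exp_affine mulrDl.
have e1 : expR (k * x) <= 1 by rewrite -expR0 ler_expR pmulr_rle0.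
have e2 : `|x| * expR (k * x) <= k^-1.
  rewrite ler0_norm// -[leRHS]mul1r ler_pdivlMr// mulrAC.
  have h := ler_wpM2r (expR_ge0 (k * x)) (expR_ge1Dx (- (k * x))).
  by rewrite -expRD addNr expR0 in h; have := expR_ge0 (k * x); lra.
apply: (le_trans (ler_normD _ _)); apply: lerD.
  by rewrite normrM (ger0_norm (expR_ge0 _)) ler_piMr.
by rewrite -mulrA !normrM (ger0_norm (expR_ge0 _)) ler_wpM2l.
Qed.

Lemma exp_affine_opp k c0 c1 x : exp_affine (- k) c0 c1 x = exp_affine k c0 (- c1) (- x).
Proof. by rewrite /exp_affine !mulrNN mulNr mulrN. Qed.

Lemma expR_decay_le (a y : R) : 0 < a -> 0 <= y -> y * expR (- (a * y)) <= a^-1.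
Proof.
move=> a0 y0; rewrite -[leRHS]mul1r ler_pdivlMr// mulrAC.
have h := ler_wpM2r (expR_ge0 (- (a * y))) (expR_ge1Dx (a * y)).
by rewrite -expRD subrr expR0 in h; have := expR_ge0 (- (a * y)); lra.
Qed.

(** The truncation [max 0 (- x)] puts the support in the negative half-line.
    The function vanishes at [0], so it is Lipschitz on the whole line, as the
    Taylor estimate requires of second derivatives. *)
Definition left_bump (a x : R) : R := Num.max 0 (- x) * expR (- (a * Num.max 0 (- x))).

Lemma left_bump_ge0 a x : 0 <= left_bump a x.
Proof. by rewrite mulr_ge0 ?expR_ge0// le_max lexx. Qed.

Lemma left_bump_pos a x : 0 <= x -> left_bump a x = 0.
Proof. by move=> x0; rewrite /left_bump (max_idPl _) ?oppr_le0// mul0r. Qed.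

Lemma left_bump_neg a x : 0 <= x -> left_bump a (- x) = x * expR (- (a * x)).
Proof. by move=> x0; rewrite /left_bump opprK (max_idPr x0). Qed.

Lemma left_bump_lipschitz a u v : 0 < a -> `|left_bump a u - left_bump a v| <= `|u - v|.
Proof.
move=> a0; pose Q y := y * expR (- (a * y)).
suff H y y' : 0 <= y' -> y' <= y -> `|Q y - Q y'| <= y - y'.
  rewrite /left_bump; set y := Num.max 0 (- u); set y' := Num.max 0 (- v).
  have y0 : 0 <= y by rewrite le_max lexx.
  have y'0 : 0 <= y' by rewrite le_max lexx.
  apply: (@le_trans _ _ `|y - y'|).
    have [yy|yy] := leP y' y; first by rewrite [leRHS]ger0_norm ?subr_ge0// H.
    by rewrite distrC [leRHS]ltr0_norm ?subr_lt0// opprB H// ltW.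
  rewrite /y /y'; have [u0|u0] := leP 0 (- u); have [v0|v0] := leP 0 (- v);
    rewrite ?subrr ?normr0//.
  - by rewrite opprK addrC distrC.
  - by rewrite subr0 ger0_norm// [leRHS]ler0_norm; lra.
  - by rewrite sub0r opprK ler0_norm ?[leRHS]ger0_norm; lra.
move=> y'0 yy; have y0 : 0 <= y := le_trans y'0 yy.
have e1 : expR (- (a * y)) <= expR (- (a * y')) by rewrite ler_expR lerN2 ler_wpM2l// ltW.
have e2 : expR (- (a * y')) <= 1 by rewrite -expR0 ler_expR oppr_le0 mulr_ge0// ltW.
have e3 := expR_ge0 (- (a * y')).
rewrite /Q ler_norml; apply/andP; split; last first.
  have := ler_wpM2l y0 e1; have : (y - y') * expR (- (a * y')) <= y - y'.
    by rewrite ler_piMr// subr_ge0.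
  lra.
have e4 : y' * expR (- (a * y')) * a <= 1.
  have h := ler_wpM2r e3 (expR_ge1Dx (a * y')); rewrite -expRD subrr expR0 in h; lra.
have e5 : expR (- (a * y')) - expR (- (a * y)) <= expR (- (a * y')) * (a * (y - y')).
  have -> : expR (- (a * y)) = expR (- (a * y')) * expR (- (a * (y - y'))).
    by rewrite -expRD; congr expR; ring.
  have := ler_wpM2l e3 (expR_ge1Dx (- (a * (y - y')))); lra.
have e6 : y' * (expR (- (a * y')) - expR (- (a * y))) <= y - y'.
  apply: (le_trans (ler_wpM2l y'0 e5)).
  have -> : y' * (expR (- (a * y')) * (a * (y - y'))) = (y' * expR (- (a * y')) * a) * (y - y').
    by ring.
  by rewrite ler_piMl// subr_ge0.
have : y' * expR (- (a * y)) <= y * expR (- (a * y)) by rewrite ler_wpM2r ?expR_ge0.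
lra.
Qed.

Lemma left_bump_bounded_mfun (a : R) : 0 < a -> bounded_mfun (left_bump a).
Proof.
move=> a0; split.
  apply: measurable_funM; first exact: measurable_maxr.
  apply: measurableT_comp => //; apply: measurableT_comp => //.
  by apply: measurable_funM => //; exact: measurable_maxr.
exists (a^-1) => x; rewrite ger0_norm ?left_bump_ge0//.
have [x0|x0] := leP 0 x; first by rewrite left_bump_pos// invr_ge0 ltW.
have nx0 : 0 <= - x by rewrite oppr_ge0 ltW.
by rewrite -[x]opprK left_bump_neg// expR_decay_le.
Qed.

Variables (beta a : R).
Hypotheses (beta0 : 0 < beta) (beta_a : beta < a).

Let a0 : 0 < a. Proof. exact: lt_trans beta0 beta_a. Qed.

(** The bounded solution of [f - f2 / beta ^+ 2 = left_bump a]. On the right it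
    is a multiple of [expR (- beta * x)]; on the left [D] and [e] give a
    particular solution, and [C] the multiple of [expR (beta * x)] that makes
    [f] continuous. The value [c0] of [f] at [0] is then the one for which the
    derivatives match: it is the mean of [left_bump a] under the two-sided
    exponential law of rate [beta]. *)
Let e := beta ^+ 2 / (beta ^+ 2 - a ^+ 2).
Let D := - (2 * a * e ^+ 2 / beta ^+ 2).
Let c0 := beta / 2 / (a + beta) ^+ 2.
Let C := c0 - D.

Let n x := exp_affine beta C 0 x + exp_affine a D (- e) x.
Let n1 x := exp_affine beta (beta * C) 0 x + exp_affine a (a * D - e) (- (a * e)) x.
Let n2 x := exp_affine beta (beta * (beta * C)) 0 x +
  exp_affine a (- (a * e) + a * (a * D - e)) (- (a * (a * e))) x.
Let p := exp_affine (- beta) c0 0.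
Let p1 := exp_affine (- beta) (- (beta * c0)) 0.
Let p2 := exp_affine (- beta) (beta * (beta * c0)) 0.

Let f (x : R) : R := if x <= 0 then n x else p x.
Let f1 (x : R) : R := if x <= 0 then n1 x else p1 x.
(** The second derivative of [f], read off from the equation it solves: bounds
    and regularity of [f2] follow from those of [f] and [left_bump a]. *)
Let f2 (x : R) : R := beta ^+ 2 * (f x - left_bump a x).

Let b2 : beta != 0. Proof. by rewrite gt_eqF. Qed.
Let ab1 : a + beta != 0. Proof. by rewrite gt_eqF// addr_gt0. Qed.
Let ab2 : beta - a != 0. Proof. by rewrite lt_eqF// subr_lt0. Qed.
Let ab3 : beta ^+ 2 - a ^+ 2 != 0.
Proof. by rewrite subr_sqr mulf_neq0// addrC. Qed.

Let dn (u : R) : is_derive u 1 n (n1 u).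
Proof.
have -> : n = exp_affine beta C 0 + exp_affine a D (- e) by [].
have d1 := is_derive_exp_affine beta C 0 u.
have d2 := is_derive_exp_affine a D (- e) u.
apply: is_derive_eq.
rewrite /n1 /exp_affine; ring.
Qed.

Let dn1 (u : R) : is_derive u 1 n1 (n2 u).
Proof.
have -> : n1 = exp_affine beta (beta * C) 0 + exp_affine a (a * D - e) (- (a * e)) by [].
have d1 := is_derive_exp_affine beta (beta * C) 0 u.
have d2 := is_derive_exp_affine a (a * D - e) (- (a * e)) u.
apply: is_derive_eq.
rewrite /n2 /exp_affine; ring.
Qed.

Let dp (u : R) : is_derive u 1 p (p1 u).
Proof.
apply: (is_derive_eq (is_derive_exp_affine (- beta) c0 0 u)).
rewrite /p1 /exp_affine; ring.
Qed.

Let dp1 (u : R) : is_derive u 1 p1 (p2 u).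
Proof.
apply: (is_derive_eq (is_derive_exp_affine (- beta) (- (beta * c0)) 0 u)).
rewrite /p2 /exp_affine; ring.
Qed.

Let exp_affine0 k c c' : exp_affine k c c' 0 = c.
Proof. by rewrite /exp_affine !mulr0 addr0 expR0 mulr1. Qed.

Let df (u : R) : is_derive u 1 f (f1 u).
Proof.
apply: (is_derive_glue dn dp).
- by rewrite /n /p !exp_affine0 subrK.
- rewrite /n1 /p1 !exp_affine0 /C /D /c0 /e; field.
  by rewrite ab3 ab1 b2.
Qed.

Let f2E u : f2 u = if u <= 0 then n2 u else p2 u.
Proof.
rewrite /f2 /f; case: (leP u 0) => u0.
  rewrite -[u in left_bump a u]opprK left_bump_neg ?oppr_ge0// /n /n2 /exp_affine mulrN opprK.
  rewrite /C /D /c0 /e; field.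
  by rewrite ab3 ab1 b2.
by rewrite left_bump_pos ?ltW// subr0 /p /p2 /exp_affine; ring.
Qed.

Let df1 (u : R) : is_derive u 1 f1 (f2 u).
Proof.
rewrite f2E; apply: (is_derive_glue dn1 dp1).
- rewrite /n1 /p1 !exp_affine0 /C /D /c0 /e; field.
  by rewrite ab3 ab1 b2.
- rewrite /n2 /p2 !exp_affine0 /C /D /c0 /e; field.
  by rewrite ab3 ab1 b2.
Qed.

Let f_bounded : exists M : R, forall x, `|f x| <= M.
Proof.
exists ((`|C| + `|0 : R| / beta) + (`|D| + `|- e| / a) + (`|c0| + `|- (0 : R)| / beta)) => x.
have h (c c1 k : R) : 0 < k -> 0 <= `|c| + `|c1| / k.
  by move=> k0; rewrite addr_ge0// divr_ge0// ltW.
rewrite /f /n /p; case: (leP x 0) => x0.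
  rewrite -[leLHS]addr0; apply: lerD; last exact: h.
  by apply: (le_trans (ler_normD _ _)); apply: lerD; exact: exp_affine_bound.
rewrite exp_affine_opp -[leLHS]add0r; apply: lerD; first by apply: addr_ge0; exact: h.
by apply: exp_affine_bound => //; rewrite oppr_le0 ltW.
Qed.

Let f1_bounded : exists M : R, forall x, `|f1 x| <= M.
Proof.
exists ((`|beta * C| + `|0 : R| / beta) + (`|a * D - e| + `|- (a * e)| / a) + (`|- (beta * c0)| + `|- (0 : R)| / beta)) => x.
have h (c c1 k : R) : 0 < k -> 0 <= `|c| + `|c1| / k.
  by move=> k0; rewrite addr_ge0// divr_ge0// ltW.
rewrite /f1 /n1 /p1; case: (leP x 0) => x0.
  rewrite -[leLHS]addr0; apply: lerD; last exact: h.
  by apply: (le_trans (ler_normD _ _)); apply: lerD; exact: exp_affine_bound.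
rewrite exp_affine_opp -[leLHS]add0r; apply: lerD; first by apply: addr_ge0; exact: h.
by apply: exp_affine_bound => //; rewrite oppr_le0 ltW.
Qed.

(** On the left the coefficient [e] is negative, but [a > beta] makes the
    exponential gap [expR (beta * x) - expR (a * x)] large enough to
    compensate. *)
Let f_ge0 x : 0 <= f x.
Proof.
have c00 : 0 < c0 by rewrite /c0 !divr_gt0// exprn_gt0// addr_gt0.
rewrite /f; case: (leP x 0) => x0; last first.
  by rewrite /p /exp_affine mul0r addr0 mulr_ge0 ?expR_ge0// ltW.
have e_lt0 : e < 0 by rewrite /e pmulr_rlt0 ?exprn_gt0// invr_lt0 subr_lt0 ltr_pXn2r ?nnegrE ?ltW.
have De : 0 <= - D * (a - beta) + e.
  have -> : - D * (a - beta) + e = - e * ((a - beta) / (a + beta)).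
    rewrite /D /e; field; by rewrite ab3 ab1 b2.
  by rewrite mulr_ge0 ?divr_ge0 ?oppr_ge0 ?subr_ge0 ?ltW ?addr_gt0.
have D_le0 : D <= 0.
  by rewrite oppr_le0 divr_ge0 ?sqr_ge0// mulr_ge0 ?sqr_ge0// mulr_ge0// ltW.
have [y0 u0] : 0 <= - x /\ 0 <= expR (a * x) by rewrite oppr_ge0 expR_ge0.
have v0 := expR_ge0 (beta * x).
have vE : expR (beta * x) = expR (a * x) * expR ((a - beta) * - x).
  by rewrite -expRD; congr expR; ring.
have vu : expR (a * x) * ((a - beta) * - x) <= expR (beta * x) - expR (a * x).
  by have := ler_wpM2l u0 (expR_ge1Dx ((a - beta) * - x)); rewrite -vE; lra.
have -> : n x = c0 * expR (beta * x) + (- D * (expR (beta * x) - expR (a * x)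
    - expR (a * x) * ((a - beta) * - x)) + (- D * (a - beta) + e) * (expR (a * x) * - x)).
  by rewrite /n /exp_affine /C; ring.
apply: addr_ge0; first by rewrite mulr_ge0// ltW.
apply: addr_ge0; apply: mulr_ge0 => //.
- by rewrite oppr_ge0.
- by rewrite subr_ge0.
- by rewrite mulr_ge0.
Qed.

Lemma test_function_exists : exists g g1 g2 : R -> R, exists K : R,
  [/\ bounded_mfun g, forall x, 0 <= g x, bounded_mfun g2, g x @[x --> 0] --> g 0 &
   [/\ forall x z, `|g (x + z) - (g x + z * g1 x + z ^+ 2 / 2 * g2 x)| <=
       z ^+ 2 * (K * Num.min 1 `|z|),
    forall x, g x - (beta ^+ 2)^-1 * g2 x = left_bump a x &
    g 0 = beta / 2 / (a + beta) ^+ 2]].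
Proof.
have cf : continuous f.
  move=> x; apply/differentiable_continuous/derivable1_diffP; have [] := df x; by [].
have bf : bounded_mfun f by split=> //; exact: continuous_measurable_fun.
have bb := left_bump_bounded_mfun a0.
have bf2 : bounded_mfun f2 by apply: bounded_mfunZ; exact: bounded_mfunB.
have [_ [M2 f2M]] := bf2; have [M1 f1M] := f1_bounded.
have M20 : 0 <= M2 := le_trans (normr_ge0 _) (f2M 0).
have M10 : 0 <= M1 := le_trans (normr_ge0 _) (f1M 0).
pose K := 2 * M2 + beta ^+ 2 * (M1 + 1).
have K0 : 0 <= K by rewrite addr_ge0 ?mulr_ge0 ?exprn_ge0 ?addr_ge0// ltW.
exists f, f1, f2, K; split => //; first exact: cf.
split.
- apply: (second_order_taylor (w := fun s => K * Num.min 1 s) df df1) => [s t st|u v].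
    rewrite ler_wpM2l// le_min !ge_min lexx/= st orbT//.
  rewrite /= minr_pMr// mulr1 le_min; apply/andP; split.
    rewrite (le_trans (ler_normB _ _))// /K mulrDl mul1r -[leLHS]addr0 lerD ?lerD//.
    by rewrite mulr_ge0 ?exprn_ge0 ?addr_ge0// ltW.
  rewrite /f2 -mulrBr normrM ger0_norm ?sqr_ge0//.
  have fl : `|f u - f v| <= M1 * `|u - v|.
    have := @mean_value_le _ f f1 M1 0 v u df; rewrite mul0r subr0; apply => c _.
    by rewrite subr0.
  have := left_bump_lipschitz u v a0 => gl.
  have -> : f u - left_bump a u - (f v - left_bump a v) = (f u - f v) - (left_bump a u - left_bump a v) by ring.
  apply: (@le_trans _ _ (beta ^+ 2 * ((M1 + 1) * `|u - v|))).
    rewrite ler_wpM2l ?sqr_ge0//; apply: (le_trans (ler_normB _ _)); rewrite mulrDl mul1r lerD//.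
  by rewrite mulrA; apply: ler_wpM2r => //; rewrite /K lerDr mulr_ge0.
- by move=> x; rewrite /f2 mulrA mulVf ?sqrf_eq0// mul1r opprB addrCA subrr addr0.
- by rewrite /f lexx /n !exp_affine0 subrK.
Qed.

End test_function.

(** * Moments of supermultiplicative functions *)

Section supermultiplicative.
Context {R : realType}.
Local Notation mu := (@lebesgue_measure R).

Lemma continuous_exp_affine (k b0 b1 : R) : continuous (exp_affine k b0 b1).
Proof.
move=> u; apply/differentiable_continuous/derivable1_diffP.
by have [] := is_derive_exp_affine k b0 b1 u.
Qed.

Lemma cvg_affine_decay (c : R) : 0 < c ->
  exp_affine (- c) (- c ^- 2) (- c^-1) y @[y --> +oo] --> (0 : R).
Proof.
move=> c0; apply/cvgrPdist_le => e e0.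
pose K := c ^- 2 + 2 / c ^+ 2.
have K0 : 0 < K by rewrite addr_gt0 ?divr_gt0 ?invr_gt0 ?exprn_gt0.
near=> y.
have y0 : 0 < y by near: y; exact: nbhs_pinfty_gt.
have c2 : 0 < c / 2 by rewrite divr_gt0.
have h1 : y * expR (- (c / 2 * y)) <= (c / 2)^-1 by apply: expR_decay_le => //; exact: ltW.
have hE : expR (- (c * y)) = expR (- (c / 2 * y)) * expR (- (c / 2 * y)).
  by rewrite -expRD; congr expR; field.
have e1 := expR_ge0 (- (c / 2 * y)).
have e2 : expR (- (c / 2 * y)) <= 1 by rewrite -[leRHS]expR0 ler_expR oppr_le0; apply: mulr_ge0; exact: ltW.
have h2 : expR (- (c / 2 * y)) <= (c / 2)^-1 / y by rewrite ler_pdivlMr// mulrC.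
rewrite sub0r normrN /exp_affine (mulNr c y) hE.
have -> : (- c ^- 2 + - c^-1 * y) * (expR (- (c / 2 * y)) * expR (- (c / 2 * y))) =
  - ((c ^- 2 * expR (- (c / 2 * y)) + c^-1 * (y * expR (- (c / 2 * y)))) * expR (- (c / 2 * y))) by ring.
have ci0 : 0 <= c^-1 by rewrite invr_ge0 ltW.
have ci20 : 0 <= c ^- 2 by rewrite invr_ge0 sqr_ge0.
have s0 : 0 <= c ^- 2 * expR (- (c / 2 * y)) + c^-1 * (y * expR (- (c / 2 * y))).
  by rewrite addr_ge0// mulr_ge0// mulr_ge0// ltW.
rewrite normrN ger0_norm ?mulr_ge0//.
apply: (@le_trans _ _ (K * ((c / 2)^-1 / y))).
  apply: ler_pM => //; apply: lerD; first by rewrite ler_piMr.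
  apply: (@le_trans _ _ (c^-1 * (c / 2)^-1)); first by rewrite ler_wpM2l.
  by rewrite le_eqVlt; apply/orP; left; apply/eqP; field; rewrite gt_eqF.
rewrite mulrA ler_pdivrMr// -ler_pdivrMl//.
Unshelve. all: by end_near. Qed.

Lemma integral_affine_decay (c : R) : 0 < c ->
  (\int[mu]_(y in `[0%R, +oo[) (y * expR (- (c * y)))%:E = (c ^- 2)%:E)%E.
Proof.
move=> c0.
pose F := exp_affine (- c) (- c ^- 2) (- c^-1).
have dF (u : R) : is_derive u 1 F (u * expR (- (c * u))).
  apply: (is_derive_eq (is_derive_exp_affine _ _ _ u)).
  rewrite /exp_affine [X in X * _](_ : _ = u); last by field; rewrite gt_eqF.
  by rewrite mulNr.
rewrite (@ge0_continuous_FTC2y _ _ F _ 0)//.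
- by rewrite sub0e /F /exp_affine mulr0 addr0 mulr0 expR0 mulr1 EFinN oppeK.
- by move=> y y0; rewrite mulr_ge0 ?expR_ge0.
- apply: continuous_subspaceT.
  have -> : (fun y => y * expR (- (c * y))) = exp_affine (- c) 0 1.
    by apply/funext => y; rewrite /exp_affine add0r mul1r mulNr.
  exact: continuous_exp_affine.
- exact: cvg_affine_decay.
- by apply: cvg_at_right_filter; exact: continuous_exp_affine.
- by move=> y _; rewrite derive1E; have [_] := dF y.
Qed.

Variables (psi : R -> R) (c x : R).
Hypotheses (mpsi : measurable_fun [set: R] psi) (psi0 : forall y, 0 <= psi y)
  (psi1 : forall y, psi y <= 1) (psiM : forall y z, psi y * psi z <= psi (y + z)).
Hypotheses (c0 : 0 < c) (x0 : 0 < x).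

Let E y := expR (- (c * y)) * psi y.

Let E0 y : 0 <= E y. Proof. by rewrite mulr_ge0// expR_ge0. Qed.

Let mE : measurable_fun [set: R] E.
Proof. by apply: measurable_funM => //; exact: measurable_expR_decay. Qed.

Let w := E x.

Let w1 : w < 1.
Proof.
apply: (@le_lt_trans _ _ (expR (- (c * x)))); first by rewrite ler_piMr// expR_ge0.
by rewrite -expR0 ltr_expR oppr_lt0 mulr_gt0.
Qed.

Let EM y z : E y * E z <= E (y + z).
Proof.
rewrite /E mulrACA -expRD -opprD -mulrDr; apply: ler_wpM2l => //; exact: expR_ge0.
Qed.

Let J := \int[mu]_(y in `[0, +oo[) E y.
Let I := \int[mu]_(y in `[0, x[) E y.

Definition first_moment := \int[mu]_(y in `[0, +oo[) (y * E y).

Let tail_shift (g : R -> R) : measurable_fun setT g -> (forall y, 0 <= y -> 0 <= g y) ->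
  (\int[mu]_(y in `[0%R, +oo[) (g y)%:E = \int[mu]_(y in `[0%R, x[) (g y)%:E +
    \int[mu]_(y in `[0%R, +oo[) (g (y + x)%R)%:E)%E.
Proof.
move=> mg g0.
transitivity (\int[mu]_(t in `[0%R, x[ `|` `[x, +oo[) (g t)%:E)%E.
  by rewrite -itv_bndbnd_setU//= bnd_simp ltW.
rewrite ge0_integral_setU//; last 3 first.
- by apply/measurable_EFinP; exact: measurable_funTS.
- move=> y [] /=; rewrite in_itv/= => /andP[h h']; rewrite lee_fin g0//.
  by apply: le_trans h; exact: ltW.
- apply/disj_setPS => t [] /=; rewrite !in_itv/= andbT => /andP[_ ts] st.
  by have := lt_le_trans ts st; rewrite ltxx.
congr (_ + _)%E.
pose k := (fun y => (g y)%:E) \_ `[x, +oo[%classic.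
have mk : measurable_fun setT k.
  by apply/(measurable_restrictT _ _).1 => //; apply: measurable_funTS; exact/measurable_EFinP.
rewrite integral_mkcond -(ge0_integral_shift x)//; last first.
  move=> y; apply: erestrict_ge0 => z; rewrite /= in_itv/= andbT => h.
  by rewrite lee_fin g0// (le_trans _ h)// ltW.
rewrite [RHS]integral_mkcond; apply: eq_integral => t _; rewrite !patchE.
by congr (if _ then _ else _); apply/idP/idP; rewrite !inE/= !in_itv/= !andbT lerDr.
Qed.

Let iE : mu.-integrable `[0, +oo[ (EFin \o E).
Proof.
apply: (@le_integrable _ _ _ mu _ _ _ (fun y : R => (expR (- (c * y)))%:E)) => //.
- by apply/measurable_EFinP; exact: measurable_funTS.
- move=> y _; rewrite lee_fin !ger0_norm ?expR_ge0//; rewrite /E ler_piMr// expR_ge0//.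
- apply/integrableP; split.
    by apply/measurable_EFinP; apply: measurable_funTS; exact: measurable_expR_decay.
  under eq_integral do rewrite /= ger0_norm ?expR_ge0//.
  by rewrite integral_expR_decay// ltry.
Qed.

Let iyE : mu.-integrable `[0, +oo[ (EFin \o (fun y => y * E y)).
Proof.
apply: (@le_integrable _ _ _ mu _ _ _ (fun y : R => (y * expR (- (c * y)))%:E)) => //.
- by apply/measurable_EFinP; apply: measurable_funTS; exact: measurable_funM.
- move=> y; rewrite /= in_itv/= andbT => y0; rewrite lee_fin !ger0_norm ?mulr_ge0 ?expR_ge0//.
  by rewrite /E ler_wpM2l// ler_piMr// expR_ge0.
- apply/integrableP; split.
    apply/measurable_EFinP; apply: measurable_funTS; apply: measurable_funM => //.
    exact: measurable_expR_decay.
  apply: (@le_lt_trans _ _ (c ^- 2)%:E); last exact: ltry.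
  rewrite -integral_affine_decay// le_eqVlt; apply/orP; left; apply/eqP.
  apply: eq_integral => y; rewrite inE/= in_itv/= andbT => y0.
  by rewrite ger0_norm// mulr_ge0 ?expR_ge0.
Qed.

Lemma first_moment_integrable : mu.-integrable `[0, +oo[
  (EFin \o (fun y => y * (expR (- (c * y)) * psi y))).
Proof. exact: iyE. Qed.

Lemma first_moment_le : first_moment <= c ^- 2.
Proof.
rewrite -lee_fin fineK; last exact: integrable_fin_num.
rewrite -integral_affine_decay//; apply: ge0_le_integral => //.
- by move=> y; rewrite /= in_itv/= andbT => y0; rewrite lee_fin mulr_ge0.
- by apply/measurable_EFinP; apply: measurable_funTS; exact: measurable_funM.
- apply/measurable_EFinP; apply: measurable_funTS; apply: measurable_funM => //.
  exact: measurable_expR_decay.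
- move=> y; rewrite /= in_itv/= andbT => y0; rewrite lee_fin ler_wpM2l// ler_piMr// expR_ge0//.
Qed.

(** Both this inequality and the next one split the half-line at [x] and bound
    the tail from below by supermultiplicativity, so that the integral
    reappears, multiplied by [w]. *)
Let J_ge : I + w * J <= J.
Proof.
have JE : J%:E = (\int[mu]_(y in `[0%R, +oo[) (E y)%:E)%E.
  by rewrite fineK//; exact: integrable_fin_num.
have IE : I%:E = (\int[mu]_(y in `[0%R, x[) (E y)%:E)%E.
  rewrite fineK//; apply: integrable_fin_num => //; apply: integrableS iE => //.
  by move=> y /=; rewrite !in_itv/= => /andP[->].
rewrite -lee_fin EFinD EFinM JE IE.
rewrite [leRHS]tail_shift// leeD2l// -ge0_integralZl//; last 3 first.
- by apply/measurable_EFinP; exact: measurable_funTS.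
- by move=> y _; rewrite lee_fin E0.
- by rewrite lee_fin; exact: E0.
apply: ge0_le_integral => //.
- by move=> y _; rewrite -EFinM lee_fin; apply: mulr_ge0; exact: E0.
- by apply/measurable_EFinP; apply: measurable_funTS; exact: measurable_funM.
- apply/measurable_EFinP; apply: measurable_funTS; apply: measurableT_comp => //.
  exact: measurable_funD.
- by move=> y _; rewrite -EFinM lee_fin addrC EM.
Qed.

Let first_moment_ge_step : w * (first_moment + x * J) <= first_moment.
Proof.
have ixE : mu.-integrable `[0, +oo[ (EFin \o (fun y => x * E y)).
  by apply: (integrable_bounded_mfunM _ (bounded_mfun_cst x) iE).
have iyxE : mu.-integrable `[0, +oo[ (EFin \o (fun y => y * E y + x * E y)).
  have h mD := integrableD mD iyE ixE.
  exact: (h (measurable_itv _)).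
have -> : first_moment + x * J = \int[mu]_(y in `[0, +oo[) (y * E y + x * E y).
  rewrite RintegralD//.
  by rewrite RintegralZl.
rewrite -lee_fin EFinM.
have -> : (\int[mu]_(y in `[0, +oo[) (y * E y + x * E y))%:E =
    (\int[mu]_(y in `[0%R, +oo[) (y * E y + x * E y)%:E)%E.
  by rewrite fineK//; exact: integrable_fin_num.
have -> : first_moment%:E = (\int[mu]_(y in `[0%R, +oo[) (y * E y)%:E)%E.
  by rewrite fineK//; exact: integrable_fin_num.
have mxE : measurable_fun [set: R] (fun y => y * E y) by exact: measurable_funM.
rewrite [leRHS]tail_shift//; last by move=> y y0; rewrite mulr_ge0.
rewrite -ge0_integralZl//; last 3 first.
- apply/measurable_EFinP; apply: measurable_funTS; apply: measurable_funD => //.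
  exact: measurable_funM.
- move=> y; rewrite /= in_itv/= andbT => y0; rewrite lee_fin.
  by rewrite addr_ge0 ?mulr_ge0// ltW.
- by rewrite lee_fin; exact: E0.
rewrite -[leLHS]add0e; apply: leeD.
  apply: integral_ge0 => y; rewrite /= in_itv/= => /andP[y0 _].
  by rewrite lee_fin mulr_ge0.
apply: ge0_le_integral => //.
- move=> y; rewrite /= in_itv/= andbT => y0; rewrite -EFinM lee_fin.
  by apply: mulr_ge0; [exact: E0 | rewrite addr_ge0 ?mulr_ge0// ltW].
- apply/measurable_EFinP; apply: measurable_funTS; apply: measurable_funM => //.
  by apply: measurable_funD => //; exact: measurable_funM.
- apply/measurable_EFinP; apply: measurable_funTS.
  apply: measurable_funM; first exact: measurable_funD.
  by apply: measurableT_comp => //; exact: measurable_funD.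
- move=> y; rewrite /= in_itv/= andbT => y0; rewrite -EFinM lee_fin -mulrDl mulrCA.
  apply: ler_wpM2l; first by rewrite addr_ge0// ltW.
  by rewrite (addrC y); exact: EM.
Qed.

(** The bound is the sum over [k] of [k * x * w ^+ k * I], where [k * x] is the
    least value of [y] on the interval from [k * x] to [(k + 1) * x]; the two
    inequalities above sum this series. *)
Lemma first_moment_ge :
  x * E x * (\int[mu]_(y in `[0, x[) E y) / (1 - E x) ^+ 2 <= first_moment.
Proof.
rewrite -/w -/I; have w0 : 0 <= w by exact: E0.
have w10 : 0 < 1 - w by rewrite subr_gt0.
have hJ : I <= J * (1 - w) by have := J_ge; lra.
have hM : w * x * J <= first_moment * (1 - w) by have := first_moment_ge_step; lra.
rewrite ler_pdivrMr ?exprn_gt0//.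
apply: (@le_trans _ _ (w * x * (J * (1 - w)))).
  by rewrite (mulrC x) ler_wpM2l// mulr_ge0// ltW.
by rewrite expr2 mulrA [leRHS]mulrA ler_wpM2r// ltW.
Qed.

End supermultiplicative.

(** * The slope of the renormalized zero resolvent *)

Section slope.
Context {R : realType} {d : measure_display} {Omega : measurableType d}.
Variable P : probability Omega R.
Variable X : R -> {RV P >-> R}.
Hypothesis X_levy : levy_process X.
Hypothesis X_recurrent : recurrent X.
Local Notation mu := (@lebesgue_measure R).
Variable r_ : nat -> R -> R.
Let q_ n : R := n.+1%:R^-1.
Hypothesis r_density : forall n, resolvent_density X (q_ n) (r_ n).
Variable h : R -> R.
Hypothesis h_limit : forall x, r_ n 0 - r_ n (- x) @[n --> \oo] --> h x.
Hypothesis X1_integrable : P.-integrable setT (EFin \o X 1).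
Hypothesis X1_sqr_integrable : P.-integrable setT (EFin \o (fun w => X 1 w ^+ 2)).
Let s2 := \int[P]_w (X 1 w ^+ 2).
Hypothesis s2_gt0 : 0 < s2.
(** Either sign: [sigma] reflects the line, so that both half-lines are treated
    at once. *)
Variable sigma : R.
Hypothesis sigma_sqr : sigma * sigma = 1.

Let q_gt0 n : 0 < q_ n. Proof. by rewrite invr_gt0 ltr0n. Qed.

Let q_cvg : q_ n @[n --> \oo] --> 0. Proof. exact: cvg_harmonic. Qed.

Let sq n := Num.sqrt (q_ n).

Let sq_gt0 n : 0 < sq n. Proof. by rewrite sqrtr_gt0. Qed.

Let sq_sqr n : sq n ^+ 2 = q_ n. Proof. by rewrite sqr_sqrtr// ltW. Qed.

Let sq_cvg : sq n @[n --> \oo] --> (0 : R).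
Proof.
by rewrite -[X in _ --> X]sqrtr0; apply: continuous_cvg => //; exact: sqrt_continuous.
Qed.

Let r0_gt0 n : 0 < r_ n 0 := resolvent0_gt0 X_levy (q_gt0 n) (r_density n).

Let r_ge0 n x : 0 <= r_ n x := resolvent_ge0 (r_density n) x.

Let psi n y := r_ n (- (sigma * y)) / r_ n 0.

Let measurable_psi n : measurable_fun [set: R] (psi n).
Proof.
apply: measurable_funM => //; have [mr _] := resolvent_bounded_mfun (r_density n).
by apply: measurableT_comp => //; apply: measurableT_comp => //; exact: measurable_funM.
Qed.

Let psi_ge0 n y : 0 <= psi n y.
Proof. by apply: divr_ge0 => //; exact: ltW. Qed.

Let psi_le1 n y : psi n y <= 1.
Proof. by rewrite ler_pdivrMr// mul1r (resolvent_le0 X_levy (q_gt0 n) (r_density n)). Qed.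

Let psi_mul n y z : psi n y * psi n z <= psi n (y + z).
Proof.
rewrite /psi mulrACA -invfM ler_pdivrMr ?mulr_gt0// -mulrA (mulrC (r_ n 0)^-1) mulfK ?gt_eqF//.
have := resolvent_mul_le X_levy (q_gt0 n) (r_density n) (- (sigma * y)) (- (sigma * z)).
by move=> /le_trans; apply; rewrite -opprD -mulrDr mulrC.
Qed.

Let psi_cvg1 y : psi n y @[n --> \oo] --> (1 : R).
Proof. exact: (resolvent_ratio_cvg1 X_levy X_recurrent r_density h_limit). Qed.

Lemma ge0_integral_signed (g : R -> \bar R) : measurable_fun [set: R] g ->
  (forall x, (0 <= g x)%E) -> (\int[mu]_x g (- (sigma * x))%R = \int[mu]_x g x)%E.
Proof.
move=> mg g0; have : (sigma - 1) * (sigma + 1) = 0 by rewrite -subr_sqr expr1n expr2 sigma_sqr subrr.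
move/eqP; rewrite mulf_eq0 subr_eq0 addr_eq0 => /orP[] /eqP ->.
  rewrite -[RHS]ge0_integral_reflect//.
  by apply: eq_integral => x _; rewrite mul1r.
by apply: eq_integral => x _; rewrite mulN1r opprK.
Qed.

(** The scaled test function sees only the half-line where [psi] is evaluated. *)
Let potential_bump n a : 0 < a ->
  potential (r_ n) (fun x => left_bump a (sigma * sq n * x)) =
  sq n * r_ n 0 * first_moment (psi n) (a * sq n).
Proof.
move=> a0; have [mr _] := resolvent_bounded_mfun (r_density n).
rewrite /potential /first_moment /Rintegral.
have -> : (\int[mu]_x (left_bump a (sigma * sq n * x) * r_ n x)%:E =
  \int[mu]_(y in `[0%R, +oo[) ((sq n * r_ n 0)%:E *
     (y * (expR (- (a * sq n * y)) * psi n y))%:E))%E.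
  rewrite -ge0_integral_signed.
  - rewrite [RHS]integral_mkcond; apply: eq_integral => y _.
    have -> : sigma * sq n * - (sigma * y) = - (sq n * y).
      by rewrite mulrN; congr (- _); rewrite mulrACA sigma_sqr mul1r.
    rewrite patchE; case: ifPn => y0.
      move: y0; rewrite inE/= in_itv/= andbT => y0.
      rewrite left_bump_neg ?mulr_ge0 ?(ltW (sq_gt0 n))//.
      rewrite -EFinM; congr (_%:E); rewrite /psi (mulrA a).
      by field; rewrite gt_eqF.
    rewrite left_bump_pos ?mul0r// oppr_ge0 pmulr_rle0//.
    move: y0; rewrite notin_setE/= in_itv/= andbT => /negP; rewrite -ltNge => /ltW.
    by [].
  - apply/measurable_EFinP; apply: measurable_funM => //.
    have [mb _] := left_bump_bounded_mfun a0.
    by apply: measurableT_comp => //; exact: measurable_funM.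
  - by move=> x; rewrite lee_fin mulr_ge0 ?left_bump_ge0.
rewrite ge0_integralZl//; last 3 first.
- apply/measurable_EFinP; apply: measurable_funTS; apply: measurable_funM => //.
  by apply: measurable_funM; [exact: measurable_expR_decay | exact: measurable_psi].
- move=> y; rewrite /= in_itv/= andbT => y0; rewrite lee_fin.
  by rewrite mulr_ge0// mulr_ge0// expR_ge0.
- by rewrite lee_fin mulr_ge0// ltW.
rewrite fineM//; apply: integrable_fin_num => //.
apply: (@first_moment_integrable _ (psi n)) => //; exact: mulr_gt0.
Qed.

Let beta := Num.sqrt (2 / s2).

Let beta_gt0 : 0 < beta. Proof. by rewrite sqrtr_gt0 divr_gt0. Qed.

Let beta_sqr : beta ^+ 2 = 2 / s2. Proof. by rewrite sqr_sqrtr// divr_ge0// ltW. Qed.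

(** The density at [0] of the scaled resolvent law, whose limit in the Brownian
    case is [beta / 2]. *)
Let rho n := sq n * r_ n 0.

Let rho_gt0 n : 0 < rho n. Proof. exact: mulr_gt0. Qed.

Let moment_cvg (a : R) : beta < a ->
  q_ n * (rho n * first_moment (psi n) (a * sq n)) @[n --> \oo] --> beta / 2 / (a + beta) ^+ 2.
Proof.
move=> ba; have a0 : 0 < a := lt_trans beta_gt0 ba.
have [f [f1 [f2 [K [bf f0 bf2 f_cont [f_taylor f_bump f0E]]]]]] := test_function_exists beta_gt0 ba.
rewrite -f0E.
have b_sqr n : (sigma * sq n) ^+ 2 = q_ n by rewrite exprMn sq_sqr expr2 sigma_sqr mul1r.
have centered := zero_mean X_levy X_recurrent r_density h_limit X1_integrable.
have := weak_limit X_levy r_density X1_integrable centered X1_sqr_integrable b_sqr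
  bf f0 bf2 f_cont f_taylor.
apply: cvg_trans; apply: near_eq_cvg; apply: nearW => n; congr (_ * _).
rewrite -potential_bump//; congr potential; apply/funext => x.
rewrite -f_bump; congr (_ - _ * _).
by rewrite beta_sqr invfM invrK mulrC.
Qed.

(** Since [psi <= 1], the integral whose limit is given by [moment_cvg] is at most
    [rho n / a ^+ 2]. As [a] grows the test function concentrates at [0] and
    this becomes sharp. *)
Let rho_large (t : R) : 0 < t -> t < 1 -> \forall n \near \oo, t * (beta / 2) <= rho n.
Proof.
move=> t0 t1; pose a := 2 * beta / (1 - t).
have t1' : 0 < 1 - t by rewrite subr_gt0.
(* [(a / (a + beta)) ^+ 2 > 1 - 2 * beta / (a + beta)], and the choice of
   [a] makes the right-hand side larger than [t]. *)
have ba : beta < a.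
  rewrite /a ltr_pdivlMr// (mulrC 2) ltr_pM2l//; lra.
have a0 : 0 < a := lt_trans beta_gt0 ba.
have ab0 : 0 < a + beta by rewrite addr_gt0.
have lim : t * (beta / 2) / a ^+ 2 < beta / 2 / (a + beta) ^+ 2.
  have aE : a * (1 - t) = 2 * beta by rewrite /a divfK// gt_eqF.
  rewrite ltr_pdivrMr ?exprn_gt0// mulrAC ltr_pdivlMr ?exprn_gt0//.
  rewrite (mulrC t) -mulrA ltr_pM2l ?divr_gt0//.
  have : 0 < a * a by rewrite mulr_gt0.
  have : 0 < beta * beta by rewrite mulr_gt0.
  have : 0 < a * beta by rewrite mulr_gt0.
  nra.
move/cvgr_gt: (moment_cvg ba) => /(_ _ lim); apply: filterS => n hn.
have J1 := first_moment_le (measurable_psi n) (psi_ge0 n) (psi_le1 n) (mulr_gt0 a0 (sq_gt0 n)).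
have : q_ n * (rho n * first_moment (psi n) (a * sq n)) <= rho n / a ^+ 2.
  apply: (@le_trans _ _ (q_ n * (rho n * (a * sq n) ^- 2))).
    by rewrite ler_wpM2l ?(ltW (q_gt0 n))// ler_wpM2l// ltW.
  rewrite exprMn sq_sqr le_eqVlt; apply/orP; left; apply/eqP; field.
  by rewrite !gt_eqF.
move=> /(lt_le_trans hn); rewrite ltr_pM2r ?invr_gt0 ?exprn_gt0//.
exact: ltW.
Qed.

Let head_cvg (a x : R) : 0 < a -> 0 < x ->
  \int[mu]_(y in `[0, x[) (expR (- (a * sq n * y)) * psi n y) @[n --> \oo] --> x.
Proof.
move=> a0 x0.
have {2}-> : x = \int[mu]_(y in `[0, x[) (cst (1 : R)) y.
  by rewrite /cst Rintegral_cst//= lebesgue_measure_itv/= lte_fin x0/= subr0 mul1r.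
apply: (@cvg_Rintegral_dominated _ _ _ mu `[0, x[%classic
  (fun n y => expR (- (a * sq n * y)) * psi n y) (cst 1) (cst 1)) => //.
- move=> n; apply: measurable_funTS; apply: measurable_funM; last exact: measurable_psi.
  exact: measurable_expR_decay.
- move=> y _; rewrite /cst -[X in _ --> X]mulr1; apply: cvgM; last exact: psi_cvg1.
  have -> : (1 : R) = expR (- (a * 0 * y)) by rewrite mulr0 mul0r oppr0 expR0.
  apply: continuous_cvg; first exact: continuous_expR.
  by apply: cvgN; apply: cvgMl; exact: cvgMr.
- apply: measurable_bounded_integrable => //.
    by rewrite /= lebesgue_measure_itv/=; case: ifP => // _; rewrite ltry.
  by exists 1; split; [rewrite num_real | move=> z zM y _; rewrite /= normr1 ltW].
- move=> n y; rewrite /= in_itv/= => /andP[y0 _].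
  rewrite (ger0_norm (mulr_ge0 (expR_ge0 _) (psi_ge0 n y))).
  rewrite -[leRHS]mulr1 ler_pM ?expR_ge0// -[leRHS]expR0 ler_expR oppr_le0.
  by rewrite mulr_ge0// mulr_ge0// ltW.
Qed.

(** The supermultiplicative lower bound on the moment of [psi], with
    [1 - w n] at most [sq n * D n], is compared with the limit [moment_cvg].
    The lower bound increases with [rho n], which may thus be replaced by
    [rs = t * beta / 2]; letting [n] grow and then [t] tend to [1] leaves
    [a * x + 2 * eta / beta >= (a + beta) * x], that is,
    [eta >= beta ^+ 2 * x / 2]. *)
Lemma slope_le x : 0 < x -> x / s2 <= h (sigma * x).
Proof.
move=> x0; set eta := h (sigma * x).
have eta_n_ge0 n : 0 <= r_ n 0 - r_ n (- (sigma * x)).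
  by rewrite subr_ge0 (resolvent_le0 X_levy (q_gt0 n) (r_density n)).
have eta0 : 0 <= eta.
  by apply: (cvgr_to_ge (@h_limit (sigma * x))); exact: nearW.
(* Any [a > beta] would do here. *)
pose a := 2 * beta.
have ba : beta < a by rewrite /a; have := beta_gt0; lra.
have a0 : 0 < a := lt_trans beta_gt0 ba.
have key (t : R) : 0 < t -> t < 1 -> t ^+ 2 * (3 * beta * x) <= a * x + 2 * eta / beta.
  move=> t0 t1; pose rs := t * (beta / 2).
  have rs0 : 0 < rs by rewrite mulr_gt0 ?divr_gt0.
  pose D n := a * x + (r_ n 0 - r_ n (- (sigma * x))) / rs.
  pose I n := \int[mu]_(y in `[0, x[) (expR (- (a * sq n * y)) * psi n y).
  pose w n := expR (- (a * sq n * x)) * psi n x.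
  have D0 n : 0 < D n by rewrite ltr_wpDr ?divr_ge0 ?mulr_gt0// ltW.
  have Dlim0 : 0 < a * x + eta / rs by rewrite ltr_wpDr ?divr_ge0 ?mulr_gt0// ltW.
  have lower : \forall n \near \oo,
      rs * x * w n * I n / D n ^+ 2 <= q_ n * (rho n * first_moment (psi n) (a * sq n)).
    have := rho_large t0 t1; apply: filterS => n hrho.
    have c0 : 0 < a * sq n by rewrite mulr_gt0.
    have := first_moment_ge (measurable_psi n) (psi_ge0 n) (psi_le1 n) (psi_mul n) c0 x0.
    rewrite -/(w n) -/(I n) => hJ.
    have w0 : 0 <= w n by rewrite mulr_ge0 ?expR_ge0.
    have I0 : 0 <= I n by apply: Rintegral_ge0 => y _; rewrite mulr_ge0 ?expR_ge0.
    have w1 : 1 - w n <= sq n * D n.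
      have e1 : 1 - a * sq n * x <= expR (- (a * sq n * x)) by exact: expR_ge1Dx.
      have e2 : expR (- (a * sq n * x)) <= 1.
        by rewrite -[leRHS]expR0 ler_expR oppr_le0 mulr_ge0// ltW.
      have psiE : 1 - psi n x = sq n * ((r_ n 0 - r_ n (- (sigma * x))) / rho n).
        by rewrite /psi /rho; field; rewrite !gt_eqF.
      have h1 : (r_ n 0 - r_ n (- (sigma * x))) / rho n <= (r_ n 0 - r_ n (- (sigma * x))) / rs.
        by rewrite ler_wpM2l// lef_pV2 ?posrE.
      have h2 := ler_wpM2l (ltW (sq_gt0 n)) h1.
      have h3 : expR (- (a * sq n * x)) * (1 - psi n x) <= 1 - psi n x.
        by rewrite ler_piMl// subr_ge0.
      rewrite /w /D mulrDr; lra.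
    have w2 : 0 < 1 - w n.
      rewrite subr_gt0; apply: (@le_lt_trans _ _ (expR (- (a * sq n * x)))).
        by rewrite ler_piMr// expR_ge0.
      by rewrite -[ltRHS]expR0 ltr_expR oppr_lt0 mulr_gt0.
    apply: (@le_trans _ _ (q_ n * (rs * (x * w n * I n / (1 - w n) ^+ 2)))).
      have -> : rs * x * w n * I n / D n ^+ 2 =
          q_ n * (rs * (x * w n * I n / (sq n * D n) ^+ 2)).
        by rewrite exprMn sq_sqr; field; rewrite !gt_eqF.
      rewrite ler_wpM2l ?(ltW (q_gt0 n))// ler_wpM2l ?(ltW rs0)// ler_wpM2l//.
        by rewrite mulr_ge0// mulr_ge0// ltW.
      rewrite lef_pV2 ?posrE ?exprn_gt0 ?mulr_gt0//.
      by rewrite lerXn2r ?nnegrE ?(ltW w2) ?mulr_ge0// ltW.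
    rewrite ler_wpM2l ?(ltW (q_gt0 n))//; apply: ler_pM => //; first exact: ltW.
    apply: divr_ge0; last by rewrite exprn_ge0// ltW.
    by rewrite mulr_ge0// mulr_ge0// ltW.
  have Dcvg : D n @[n --> \oo] --> a * x + eta / rs.
    by apply: cvgD; [exact: cvg_cst | apply: cvgMl; exact: h_limit].
  have wcvg : w n @[n --> \oo] --> (1 : R).
    rewrite -[X in _ --> X]mulr1; apply: cvgM; last exact: psi_cvg1.
    have -> : (1 : R) = expR (- (a * 0 * x)) by rewrite mulr0 mul0r oppr0 expR0.
    apply: continuous_cvg; first exact: continuous_expR.
    by apply: cvgN; apply: cvgMl; exact: cvgMr.
  have lcvg : rs * x * w n * I n / D n ^+ 2 @[n --> \oo] -->
      rs * x * 1 * x / (a * x + eta / rs) ^+ 2.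
    apply: cvgM.
      by apply: cvgM; [exact: cvgMr | exact: head_cvg].
    apply: cvgV; first by rewrite expf_neq0// gt_eqF.
    by rewrite !expr2; under eq_cvg do rewrite expr2; exact: cvgM.
  have : rs * x * 1 * x / (a * x + eta / rs) ^+ 2 <= beta / 2 / (a + beta) ^+ 2.
    exact: ler_cvg_to lcvg (moment_cvg ba) lower.
  rewrite mulr1 ler_pdivrMr ?exprn_gt0// [leRHS]mulrAC ler_pdivlMr ?exprn_gt0 ?addr_gt0//.
  have -> : rs * x * x * (a + beta) ^+ 2 = beta / 2 * (t * (x * (a + beta)) ^+ 2) by rewrite /rs; ring.
  rewrite ler_pM2l ?divr_gt0// => hsq.
  have hsq2 : (t * (x * (a + beta))) ^+ 2 <= (a * x + eta / rs) ^+ 2.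
    apply: (le_trans _ hsq); rewrite exprMn ler_wpM2r ?sqr_ge0// expr2.
    by apply: ler_piMl; exact: ltW.
  have hlin : t * (x * (a + beta)) <= a * x + eta / rs.
    by move: hsq2; rewrite ler_sqr ?nnegrE ?(ltW Dlim0) ?mulr_ge0 ?addr_ge0 ?(ltW x0) ?(ltW t0) ?(ltW a0) ?(ltW beta_gt0).
  have := ler_wpM2l (ltW t0) hlin.
  have -> : t * (a * x + eta / rs) = t * (a * x) + 2 * eta / beta.
    by rewrite /rs; field; rewrite !gt_eqF.
  have : t * (a * x) <= a * x by rewrite ler_piMl ?(ltW t1)// mulr_ge0// ltW.
  have -> : t * (t * (x * (a + beta))) = t ^+ 2 * (3 * beta * x) by rewrite /a; ring.
  lra.
have -> : x / s2 = beta ^+ 2 * x / 2 by rewrite beta_sqr; field; rewrite gt_eqF.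
rewrite leNgt; apply/negP => lt_eta.
have bx0 : 0 < beta ^+ 2 * x by rewrite mulr_gt0// exprn_gt0.
pose k := 2 * eta / (beta ^+ 2 * x).
have k0 : 0 <= k by rewrite divr_ge0 ?mulr_ge0// ltW.
have k1 : k < 1 by rewrite ltr_pdivrMr//; lra.
(* Close enough to [1] for [3 * t ^+ 2 - 2 > k]. *)
pose t := 1 - (1 - k) / 12.
have t0 : 0 < t by rewrite /t; lra.
have t1 : t < 1 by rewrite /t; lra.
have := key t t0 t1.
have -> : a * x + 2 * eta / beta = (2 + k) * (beta * x).
  by rewrite /a /k; field; rewrite !gt_eqF.
have -> : t ^+ 2 * (3 * beta * x) = t ^+ 2 * 3 * (beta * x) by ring.
rewrite ler_pM2r ?mulr_gt0// /t; nra.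
Qed.

End slope.

(** * The renormalized zero resolvent *)

Section renormalized.
Context {R : realType} {d : measure_display} {Omega : measurableType d}.
Variable P : probability Omega R.
Variable X : R -> {RV P >-> R}.
Hypothesis X_levy : levy_process X.
Variable r_ : nat -> R -> R.
Let q_ n : R := n.+1%:R^-1.
Hypothesis r_density : forall n, resolvent_density X (q_ n) (r_ n).
Variable h : R -> R.
Hypothesis h_limit : forall x, r_ n 0 - r_ n (- x) @[n --> \oo] --> h x.

Let q_gt0 n : 0 < q_ n. Proof. by rewrite invr_gt0 ltr0n. Qed.

Lemma zero_resolvent_ge0 x : 0 <= h x.
Proof.
apply: (cvgr_to_ge (@h_limit x)); apply: nearW => n.
by rewrite subr_ge0 (resolvent_le0 X_levy (q_gt0 n) (r_density n)).
Qed.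

Lemma zero_resolvent_subadditive : subadditive_fun h.
Proof.
move=> x y.
have hxy : r_ n 0 - r_ n (- x) + (r_ n 0 - r_ n (- y)) @[n --> \oo] --> h x + h y.
  by apply: cvgD; exact: h_limit.
have le_xy : \forall n \near \oo,
    r_ n 0 - r_ n (- (x + y)) <= r_ n 0 - r_ n (- x) + (r_ n 0 - r_ n (- y)).
  apply: nearW => n; rewrite opprD.
  exact: (resolvent_gap_subadditive X_levy (q_gt0 n) (r_density n)).
exact: ler_cvg_to (@h_limit (x + y)) hxy le_xy.
Qed.

Lemma second_moment_ge0 : (0 <= second_moment X)%E.
Proof.
rewrite /second_moment unlock; apply: integral_ge0 => w _.
by rewrite lee_fin sqr_ge0.
Qed.

Lemma second_moment_integrable (s : R) : second_moment X = s%:E ->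
  [/\ P.-integrable setT (EFin \o X 1),
      P.-integrable setT (EFin \o (fun w => X 1 w ^+ 2)) &
      \int[P]_w (X 1 w ^+ 2) = s].
Proof.
rewrite /second_moment unlock => sE.
have mX : measurable_fun setT (X 1 : Omega -> R) by exact: measurable_funPT.
have i2 : P.-integrable setT (EFin \o (fun w => X 1 w ^+ 2)).
  apply/integrableP; split; first by apply/measurable_EFinP; exact: measurable_funX.
  under eq_integral do rewrite /= ger0_norm ?sqr_ge0//.
  by rewrite sE ltry.
split => //; last by rewrite /Rintegral sE.
apply: (@le_integrable _ _ _ _ _ _ _ (fun w => (1 + X 1 w ^+ 2)%:E)) => //.
- exact/measurable_EFinP.
- move=> w _; rewrite lee_fin [leRHS]ger0_norm ?addr_ge0 ?sqr_ge0//.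
  by rewrite ler_norml; apply/andP; split; nra.
- have i1 : P.-integrable setT (EFin \o (cst 1 : Omega -> R)).
    exact: finite_measure_integrable_cst.
  exact: (integrableD measurableT i1 i2).
Qed.

Hypothesis X_recurrent : recurrent X.

(** Only a finite positive second moment needs an argument: the inverse of the
    infinite one is [0], and that of [0] is infinite, with finite part [0]. *)
Lemma zero_resolvent_ge x : fine (second_moment X)^-1%E * `|x| <= h x.
Proof.
have hx0 := zero_resolvent_ge0 x.
case E : (second_moment X) second_moment_ge0 => [s| |]// s0; last by rewrite invey mul0r.
have {s0} : 0 <= s by [].
rewrite le_eqVlt => /predU1P[<-|s0]; first by rewrite inve0 mul0r.
have [i1 i2 is2] := second_moment_integrable E.
have sl (sigma y : R) : sigma * sigma = 1 -> 0 < y -> s^-1 * y <= h (sigma * y).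
  move=> sg y0; rewrite mulrC -is2.
  by apply: (slope_le X_levy X_recurrent r_density h_limit i1 i2) => //; rewrite is2.
rewrite inver gt_eqF//=.
have [x0|x0|->] := ltgtP x 0.
- rewrite ltr0_norm//; have := sl (-1) (- x); rewrite mulrNN mulN1r opprK mulr1.
  by apply => //; rewrite oppr_gt0.
- by rewrite gtr0_norm//; have := sl 1 x; rewrite !mul1r; exact.
- by rewrite normr0 mulr0 (zero_resolvent_ge0 0).
Qed.

End renormalized.

Theorem corollary1p3 (R : realType) (d : measure_display)
    (Omega : measurableType d) (P : probability Omega R)
    (X : R -> {RV P >-> R}) (Psi : R -> R[i]) (h : R -> R) (gamma : R)
    (X_levy : levy_process X)
    (X_recurrent : recurrent X)
    (Psi_exponent : characteristic_exponent X Psi)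
    (Psi_integrable : integrable_exponent Psi)
    (h_resolvent : renormalized_zero_resolvent X h)
    (gamma_bounds : -1 <= gamma <= 1) :
  subadditive_fun (h_gamma X h gamma) /\
  (forall x : R, 0 <= h_gamma X h gamma x).
Proof.
have [r [r_density r_limit]] := h_resolvent.
pose r_ n := r n.+1%:R^-1.
have density n : resolvent_density X n.+1%:R^-1 (r_ n).
  by apply: r_density; rewrite invr_gt0 ltr0n.
have h_limit x : r_ n 0 - r_ n (- x) @[n --> \oo] --> h x.
  have /cvg_at_rightP := r_limit x; apply; split; last exact: cvg_harmonic.
  by move=> n; rewrite invr_gt0 ltr0n.
rewrite /h_gamma; set k := fine _; split => [x y|x].
  have := zero_resolvent_subadditive X_levy density h_limit x y.
  by rewrite mulrDr; lra.
have : k * `|x| <= h x := zero_resolvent_ge X_levy density h_limit X_recurrent x.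
have k0 : 0 <= k.
  by rewrite fine_ge0// inve_ge0 (second_moment_ge0 X).
have : `|gamma * k * x| <= k * `|x|.
  by rewrite -mulrA normrM normrM (ger0_norm k0) ler_piMl ?mulr_ge0// ler_norml.
rewrite ler_norml => /andP[+ _]; lra.
Qed.
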